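(* Fix any $\nu\in(0,1)\setminus\{1/2\}$, and let $\{\theta^{(\nu)}_{m,k}:m\ge0,\ 0\le k<2^m\}$ be independent random variables with $\mathbb P(\theta^{(\nu)}_{m,k}=1)=\nu$ and $\mathbb P(\theta^{(\nu)}_{m,k}=-1)=1-\nu$. Define $$Y^{(\nu)}_t:=\sum_{m=0}^\infty\sum_{k=0}^{2^m-1}\theta^{(\nu)}_{m,k}e_{m,k}(t),\qquad 0\le t\le1,$$ and put $b:=2\nu-1$. Consider the uniform thirds grids and the triadic grids $$\mathbb U_n:=\left\{\frac{j}{3\cdot2^n}:0\le j\le3\cdot2^n\right\},\qquad \mathbb T^{(3)}_n:=\left\{\frac{j}{3^n}:0\le j\le3^n\right\},$$ and the dyadic grids $\mathbb T_n:=\{k2^{-n}:0\le k\le2^n\}$. Then $$[Y^{(\nu)}]_{(\mathbb U_n)}\longrightarrow1+\frac{6+8\sqrt2}{9}\,b^2\qquad\text{almost surely as }n\to\infty .$$ In particular, this limit is strictly larger than the dyadic limit of $1$. Along the triadic grids, the quadratic sums do not converge almost surely. More precisely, there are deterministic subsequences $(n_j)$ and $(m_j)$ such that, almost surely, $$[Y^{(\nu)}]_{(\mathbb T^{(3)}_{n_j})}\longrightarrow1-\frac49b^2,\qquad [Y^{(\nu)}]_{(\mathbb T^{(3)}_{m_j})}\longrightarrow1-\frac{28}{81}b^2 .$$ The two limits differ by $8b^2/81>0$. By contrast, for every realization of the signs, $[Y^{(\nu)}]_{(\mathbb T_n)}=1-2^{-n}$, and hence the dyadic quadratic sums converge to 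$1$.
   Context: Faber--Schauder functions: for $m\ge0$ and $0\le k<2^m$, $e_{m,k}(t)=2^{-m/2}e_{0,0}(2^mt-k)$, where $e_{0,0}(u)=\max\{0,\min(u,1-u)\}$. The series defining $Y^{(\nu)}$ converges uniformly in $t$ for every choice of signs. For a finite partition $\tau=\{0=t_0<t_1<\cdots<t_N=1\}$ of $[0,1]$ and a continuous path $x$ on $[0,1]$, the terminal quadratic sum is $[x]_{(\tau)}=\sum_{i=0}^{N-1}\bigl(x(t_{i+1})-x(t_i)\bigr)^2$. *)

(* Defs.v *)
From mathcomp Require Import all_boot all_order all_algebra.
From mathcomp Require Import finmap.
From mathcomp Require Import all_classical all_reals all_analysis.

Set Implicit Arguments.
Unset Strict Implicit.
Unset Printing Implicit Defensive.

Import Order.TTheory GRing.Theory Num.Theory.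
Import numFieldNormedType.Exports.

Local Open Scope classical_set_scope.
Local Open Scope ring_scope.

Definition mutually_independent (d : measure_display) (Omega : measurableType d)
    (R : realType) (P : probability Omega R) (I : choiceType)
    (X : I -> {RV P >-> R}) : Prop :=
  forall (J : {fset I}) (B : I -> set R),
    (forall i, i \in J -> measurable (B i)) ->
    P (\bigcap_(i in [set` J]) (X i @^-1` B i)) =
      (\prod_(i <- J) P (X i @^-1` B i))%E.

Section FaberSchauder.
Variable R : realType.
Implicit Types (t u : R) (m k n N : nat).

(* tent is e_{0,0}, and faber_schauder m k is e_{m,k}. *)
Definition tent u : R := Num.max 0 (Num.min u (1 - u)).

Definition faber_schauder m k t : R :=
  2 `^ (- (m%:R / 2)) * tent (2 ^+ m * t - k%:R).

(* The double series is summed level by level: it is the limit, over M, of the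
   sum over all m < M and all k < 2 ^ m. *)
Definition faber_schauder_series (c : forall m, 'I_(2 ^ m) -> R) t : R :=
  limn (series (fun m => \sum_(k < 2 ^ m) c m k * faber_schauder m k t)).

(* A partition {t_0 < ... < t_N} is given by the increasing list of its points,
   so that N = (size tau).-1. *)
Definition quadratic_sum (x : R -> R) (tau : seq R) : R :=
  \sum_(0 <= i < (size tau).-1) (x tau`_i.+1 - x tau`_i) ^+ 2.

Definition uniform_grid N : seq R := [seq j%:R / N%:R | j <- iota 0 N.+1].

Definition thirds_grid n : seq R := uniform_grid (3 * 2 ^ n).
Definition triadic_grid n : seq R := uniform_grid (3 ^ n).
Definition dyadic_grid n : seq R := uniform_grid (2 ^ n).

End FaberSchauder.

(* Main.v *)
Require Import Defs.
From mathcomp Require Import all_boot all_order all_algebra.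
From mathcomp Require Import finmap.
From mathcomp Require Import all_classical all_reals all_analysis.
From mathcomp Require Import ring lra zify.

Set Implicit Arguments.
Unset Strict Implicit.
Unset Printing Implicit Defensive.

Import Order.TTheory GRing.Theory Num.Theory.
Import numFieldNormedType.Exports.

Local Open Scope classical_set_scope.
Local Open Scope ring_scope.

(** Write [q = 1 / sqrt 2] and [b = 2 nu - 1], and let [Q_N (x)] be the
    quadratic sum of a path [x] over the grid of mesh [1 / N]. The proof
    separates the fluctuations of [Q_N] from its mean.

    Fluctuations. Every level of the series moves by at most [sqrt h] over a
    step [h] ([level_holder]), and the total variation of a Schauder function of
    level [m] is [q ^+ m]. Hence reversing one sign of level [m], in a series of
    [M] levels, changes the quadratic sum by at most [4 M q ^+ m / sqrt N]
    ([energy_update]), and since there are [2 ^ m] signs at that level the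
    Efron-Stein inequality bounds the variance by a multiple of [M ^ 3 / N]
    ([energy_concentration]). The levels beyond [8 n] change [Q_N] by [O (N q ^+
    (8 n))], so for [N] of the order of at most [4 ^ n] only finitely many signs
    matter, all probabilities reduce to finite sums over a cube of signs, and
    the Borel-Cantelli lemma shows that [Q_N] is almost surely asymptotic to its
    mean ([ae_energy_dist]).

    Mean. A sign has mean [b] and two signs have covariance [0], or [1 - b ^+ 2]
    if they coincide. The mean of [Q_N] is therefore [b ^+ 2] times the
    quadratic sum of the path [g] with all signs [+1], a Takagi function, plus
    [1 - b ^+ 2] times the sum of the squared increments of all Schauder
    functions. By Parseval's identity for the Haar system the latter is [1 - 1 /
    N] ([sum_schauder_increments]). If [Q_N (g)] tends to [G], the random sums
    thus tend to [1 + b ^+ 2 * (G - 1)].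

    Thirds grids. The levels below [n] are affine on the dyadic cells, and all
    the others contribute the same bump at both interior third points of a cell;
    the cross terms cancel in each cell and [G = (15 + 8 sqrt 2) / 9]
    ([energy_takagi_thirds]).

    Triadic grids. For odd [N] the increments of distinct levels of [g] are
    almost orthogonal ([cross_sum_le]), which leaves the sum over [m] of [2 ^- m
    * V (2 ^ m)], where [V (a)] is the sum over the grid of the squared
    differences over [a] steps of the distance to the nearest integer. [V] is
    explicit ([variogramE]), and asymptotically this series only depends on how
    [N] is placed with respect to the powers of two: it tends to [5 / 9] if [N]
    is close to a power of two and to [53 / 81] if [N] is close to three times a
    power of two ([variogram_series]). As [ln 3 / ln 2] is irrational, [3 ^ n_j]
    is close to a power of two along some subsequence
    ([three_pow_near_two_pow]), and then [3 ^ (n_j + 1)] is close to three times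
    that power. The two limits differ, so the whole sequence diverges.

    Dyadic grids. Refining the grid halves the quadratic sum and adds [1 / 2],
    whatever the new signs ([energy_dyadic_partial]). *)

(** * The tent function and the levels of a Faber-Schauder series *)

Section Levels.
Variable R : realType.
Implicit Types (x y t u : R) (m k n N M K : nat).

Variant tent_spec u : R -> Type :=
  | TentLeft of u <= 0 : tent_spec u 0
  | TentUp of 0 <= u & u <= 1 / 2 : tent_spec u u
  | TentDown of 1 / 2 <= u & u <= 1 : tent_spec u (1 - u)
  | TentRight of 1 <= u : tent_spec u 0.

Lemma tentP u : tent_spec u (tent u).
Proof.
rewrite /tent; case: (leP u (1 - u)) => ?; case: leP => ?.
- by constructor; lra.
- by constructor 1; lra.
- by constructor 3; lra.
- by constructor 4; lra.
Qed.

Lemma tent_ge0 u : 0 <= tent u.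
Proof. by case: tentP => *; lra. Qed.

Lemma tent_le u : tent u <= 1 / 2.
Proof. by case: tentP => *; lra. Qed.

Lemma tent_left u : u <= 0 -> tent u = 0.
Proof. by case: tentP => *; lra. Qed.

Lemma tent_right u : 1 <= u -> tent u = 0.
Proof. by case: tentP => *; lra. Qed.

Lemma sum_tent_le K x : \sum_(k < K) tent (x - k%:R) <= 1 / 2.
Proof.
(* Past the last cell the whole sum vanishes, so one term at most counts. *)
suff: \sum_(k < K) tent (x - k%:R) <= 1 / 2 /\
      (K%:R <= x -> \sum_(k < K) tent (x - k%:R) = 0) by case.
elim: K => [|K [IH1 IH2]]; first by rewrite big_ord0; split=> [|//]; lra.
rewrite big_ord_recr /=; have [le_Kx|lt_xK] := leP K%:R x.
  rewrite IH2 // add0r; split; first exact: tent_le.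
  by rewrite -natr1 => ?; rewrite tent_right //; lra.
rewrite tent_left ?addr0; last lra.
by split=> //; rewrite -natr1 => ?; lra.
Qed.

Definition clamp (a u : R) : R := Num.max 0 (Num.min u a).

Variant clamp_spec (a u : R) : R -> Type :=
  | ClampLow of u <= 0 : clamp_spec a u 0
  | ClampMid of 0 <= u & u <= a : clamp_spec a u u
  | ClampHigh of a <= u : clamp_spec a u a.

Lemma clampP (a u : R) : 0 <= a -> clamp_spec a u (clamp a u).
Proof.
move=> a_ge0; rewrite /clamp; case: (leP u a) => ?.
  by case: (leP 0 u) => ?; constructor; lra.
case: (leP 0 a) => ?; last by exfalso; lra.
by constructor; lra.
Qed.

Lemma clamp_bounds (a u : R) : 0 <= a -> 0 <= clamp a u <= a.
Proof. by move=> a_ge0; apply/andP; case: (clampP u a_ge0) => *; split. Qed.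

Lemma clampD (a b u : R) : 0 <= a -> 0 <= b ->
  clamp (a + b) u = clamp a u + clamp b (u - a).
Proof.
move=> a_ge0 b_ge0.
case: (clampP u a_ge0) => *; case: (clampP (u - a) b_ge0) => *;
by case: (clampP u (addr_ge0 a_ge0 b_ge0)) => *; lra.
Qed.

Lemma tent_clamp x y : x <= y ->
  `|tent x - tent y| <= clamp 1 y - clamp 1 x.
Proof.
move=> le_xy.
have tentE u : tent u = Num.min (clamp 1 u) (1 - clamp 1 u).
  by case: (clampP u ler01) => *; case: tentP => *; case: leP => *; lra.
have : clamp 1 x <= clamp 1 y.
  by case: (clampP x ler01) => *; case: (clampP y ler01) => *; lra.
rewrite !tentE; move: (clamp 1 x) (clamp 1 y) => a b le_ab.
by rewrite ler_norml; case: (leP a _) => *; case: (leP b _) => *;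
  apply/andP; split; lra.
Qed.

(** The tent moves less than the clamping function of its cell, and the
    clamping functions of consecutive cells add up to a clamping function. *)
Lemma sum_tent_lipschitz K x y :
  \sum_(k < K) `|tent (x - k%:R) - tent (y - k%:R)| <= `|x - y|.
Proof.
wlog le_xy : x y / x <= y => [wlg|].
  have [/wlg//|/ltW/wlg le_yx] := leP x y.
  by rewrite distrC; under eq_bigr do rewrite distrC.
rewrite distrC (ger0_norm (_ : 0 <= y - x)) ?subr_ge0 //.
apply: (@le_trans _ _ (clamp K%:R y - clamp K%:R x)); last first.
  have K_ge0 : 0 <= K%:R :> R by [].
  by case: (clampP x K_ge0) => *; case: (clampP y K_ge0) => *; lra.
elim: K => [|K IH].
  rewrite big_ord0.
  by case: (clampP x (lexx 0)) => *; case: (clampP y (lexx 0)) => *; lra.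
rewrite big_ord_recr /=; apply: le_trans (lerD IH (lexx _)) _ => {IH}.
rewrite -natr1 !clampD //.
by have := @tent_clamp (x - K%:R) (y - K%:R); rewrite lerD2r; lra.
Qed.

Lemma tent_affine x y (l : R) : x <= y -> 0 <= l <= 1 ->
  [\/ y <= 0, 0 <= x /\ y <= 1 / 2, 1 / 2 <= x /\ y <= 1 | 1 <= x] ->
  tent ((1 - l) * x + l * y) = (1 - l) * tent x + l * tent y.
Proof.
move=> le_xy /andP[l_ge0 l_le1] cell.
have : x <= (1 - l) * x + l * y <= y by nra.
case/andP; set z := _ + l * y => xz zy.
have [zE|] := eqVneq z ((1 - l) * x + l * y); last by rewrite eqxx.
case: cell => [?|[? ?]|[? ?]|?].
- by rewrite !tent_left; lra.
- have tE u : 0 <= u -> u <= 1 / 2 -> tent u = u by case: tentP => *; lra.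
  by rewrite !tE; lra.
- have tE u : 1 / 2 <= u -> u <= 1 -> tent u = 1 - u by case: tentP => *; lra.
  by rewrite !tE; lra.
- by rewrite !tent_right; lra.
Qed.

(** The kinks of the integer translates of the tent are half-integers, which
    are multiples of [2 ^- r] as soon as [r] is positive. *)
Lemma tent_affine_dyadic r (i k : nat) (l : R) : (0 < r)%N -> 0 <= l <= 1 ->
  tent ((k%:R + l) / 2 ^+ r - i%:R) =
  (1 - l) * tent (k%:R / 2 ^+ r - i%:R) + l * tent (k.+1%:R / 2 ^+ r - i%:R).
Proof.
case: r => // r _ l01.
have h_gt0 : 0 < (2 : R) ^+ r.+1 by rewrite exprn_gt0.
have h_neq0 := lt0r_neq0 h_gt0.
set x := k%:R / _ - _; set y := k.+1%:R / _ - _.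
have -> : (k%:R + l) / 2 ^+ r.+1 - i%:R = (1 - l) * x + l * y.
  by rewrite /x /y -natr1; field.
apply: tent_affine => //; rewrite /x /y.
  by rewrite lerD2r ler_pM2r ?invr_gt0 // ler_nat.
have le_div (a b : nat) : (a <= b)%N -> a%:R / 2 ^+ r.+1 <= b%:R / 2 ^+ r.+1 :> R.
  by move=> le_ab; rewrite ler_pM2r ?invr_gt0 // ler_nat.
have e0 : (i * 2 ^ r.+1)%:R / 2 ^+ r.+1 = i%:R :> R.
  by rewrite natrM natrX; field.
have e1 : (i * 2 ^ r.+1 + 2 ^ r)%:R / 2 ^+ r.+1 = i%:R + 1 / 2 :> R.
  rewrite natrD natrM !natrX exprS; field.
  by rewrite expf_neq0 // pnatr_eq0.
have e2 : (i * 2 ^ r.+1 + 2 ^ r.+1)%:R / 2 ^+ r.+1 = i%:R + 1 :> R.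
  by rewrite natrD natrM !natrX; field.
have [/le_div|/le_div] := ltnP k (i * 2 ^ r.+1).
  by rewrite e0 => ?; constructor 1; lra.
rewrite e0 => ?; have [/le_div|/le_div] := ltnP k (i * 2 ^ r.+1 + 2 ^ r).
  by rewrite e1 => ?; constructor 2; lra.
rewrite e1 => ?; have [/le_div|/le_div] := ltnP k (i * 2 ^ r.+1 + 2 ^ r.+1).
  by rewrite e2 => ?; constructor 3; lra.
by rewrite e2 => ?; constructor 4; lra.
Qed.

(** The tent is the difference of two nondecreasing functions that both
    increase by [1 / 2]. *)
Lemma tent_variation (u : nat -> R) N :
  (forall j, u j <= u j.+1) ->
  \sum_(0 <= j < N) `|tent (u j.+1) - tent (u j)| <= 1.
Proof.
move=> u_incr.
have half_ge0 : 0 <= 1 / 2 :> R by lra.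
pose up x := clamp (1 / 2) x; pose down x := up (x - 1 / 2).
have step x y : x <= y ->
    `|tent y - tent x| <= (up y - up x) + (down y - down x).
  move=> le_xy; have := tent_clamp le_xy; rewrite distrC.
  have -> : (1 : R) = 1 / 2 + 1 / 2 by lra.
  by rewrite !clampD // /down /up; lra.
apply: (@le_trans _ _ (\sum_(0 <= j < N)
    ((up (u j.+1) - up (u j)) + (down (u j.+1) - down (u j))))).
  by apply: ler_sum => j _; apply: step; exact: u_incr.
rewrite big_split /= !telescope_sumr // /down /up.
have := clamp_bounds (u N) half_ge0.
have := clamp_bounds (u N - 1 / 2) half_ge0.
have := clamp_bounds (u 0%N) half_ge0.
have := clamp_bounds (u 0%N - 1 / 2) half_ge0.
by move=> /andP[? ?] /andP[? ?] /andP[? ?] /andP[? ?]; lra.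
Qed.

Definition root_half : R := (Num.sqrt 2)^-1.
Local Notation q := root_half.

Lemma root_half_gt0 : 0 < q.
Proof. by rewrite invr_gt0 sqrtr_gt0. Qed.

Lemma root_halfX_ge0 m : 0 <= q ^+ m.
Proof. by rewrite exprn_ge0 // ltW // root_half_gt0. Qed.

Lemma root_half2 : q ^+ 2 = 1 / 2.
Proof. by rewrite exprVn sqr_sqrtr // div1r. Qed.

Lemma root_half_lt1 : q < 1.
Proof. by have := root_half2; have := root_half_gt0; nra. Qed.

Lemma root_halfX2 m : q ^+ m * q ^+ m * 2 ^+ m = 1.
Proof.
rewrite -!exprMn -expr2 root_half2.
by have -> : 1 / 2 * 2 = 1 :> R by [lra|]; rewrite expr1n.
Qed.

Lemma faber_schauderE m k t :
  faber_schauder m k t = q ^+ m * tent (2 ^+ m * t - k%:R).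
Proof.
rewrite /faber_schauder powRN; congr (_ * _).
rewrite /q exprVn; congr (_^-1).
by rewrite mulrC powRrM powR12_sqrt // powR_mulrn ?sqrtr_ge0.
Qed.

Variable c : forall m, 'I_(2 ^ m) -> R.

Definition level m t : R := \sum_(k < 2 ^ m) c k * faber_schauder m k t.

Definition partial M t : R := \sum_(0 <= m < M) level m t.

Lemma partialS M t : partial M.+1 t = partial M t + level M t.
Proof. by rewrite /partial big_nat_recr. Qed.

Lemma levelE m t : level m t =
  q ^+ m * \sum_(k < 2 ^ m) c k * tent (2 ^+ m * t - k%:R).
Proof.
rewrite mulr_sumr; apply: eq_bigr => k _.
by rewrite faber_schauderE mulrCA.
Qed.

Lemma level_affine m n k (l : R) : (m < n)%N -> 0 <= l <= 1 ->
  level m ((k%:R + l) / 2 ^+ n) =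
  (1 - l) * level m (k%:R / 2 ^+ n) + l * level m (k.+1%:R / 2 ^+ n).
Proof.
move=> lt_mn l01; rewrite !levelE ![_ * (q ^+ m * _)]mulrCA -mulrDr.
congr (_ * _); rewrite !mulr_sumr -big_split; apply: eq_bigr => i _ /=.
have scale x : 2 ^+ m * (x / 2 ^+ n) = x / 2 ^+ (n - m) :> R.
  have -> : (2 : R) ^+ n = 2 ^+ m * 2 ^+ (n - m) by rewrite -exprD subnKC // ltnW.
  by field; rewrite !expf_neq0 // pnatr_eq0.
by rewrite !scale tent_affine_dyadic ?subn_gt0 //; ring.
Qed.

Lemma level_dyadic m n k : (n <= m)%N -> level m (k%:R / 2 ^+ n) = 0.
Proof.
move=> le_nm; rewrite levelE big1 ?mulr0 // => i _.
have -> : 2 ^+ m * (k%:R / 2 ^+ n) = (k * 2 ^ (m - n))%:R :> R.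
  rewrite natrM natrX -{1}(subnKC le_nm) exprD; field.
  by rewrite expf_neq0 // pnatr_eq0.
have [le_ki|lt_ik] := leqP (k * 2 ^ (m - n)) i.
  by rewrite tent_left ?mulr0 // subr_le0 ler_nat.
by rewrite tent_right ?mulr0 // lerBrDr nat1r ler_nat.
Qed.

Lemma partial_affine n k (l : R) : 0 <= l <= 1 ->
  partial n ((k%:R + l) / 2 ^+ n) =
  (1 - l) * partial n (k%:R / 2 ^+ n) + l * partial n (k.+1%:R / 2 ^+ n).
Proof.
move=> l01; rewrite !mulr_sumr -big_split.
by apply: eq_big_nat => m /andP[_ lt_mn]; exact: level_affine.
Qed.

Lemma partial_dyadic n M k : (n <= M)%N ->
  partial M (k%:R / 2 ^+ n) = partial n (k%:R / 2 ^+ n).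
Proof.
move=> le_nM; rewrite /partial (big_cat_nat (leq0n n) le_nM) //=.
rewrite [X in _ + X]big_nat [X in _ + X]big1 ?addr0 // => m /andP[? _].
exact: level_dyadic.
Qed.

Hypothesis c_le1 : forall m (k : 'I_(2 ^ m)), `|c k| <= 1.

Lemma level_le m t : `|level m t| <= q ^+ m / 2.
Proof.
rewrite levelE normrM (ger0_norm (root_halfX_ge0 m)).
rewrite ler_wpM2l ?root_halfX_ge0 //.
apply: le_trans (ler_norm_sum _ _ _) _; rewrite -[leRHS]div1r.
apply: le_trans (sum_tent_le (2 ^ m) (2 ^+ m * t)).
apply: ler_sum => k _; rewrite normrM (ger0_norm (tent_ge0 _)).
by rewrite ler_piMl // tent_ge0.
Qed.

Lemma level_lipschitz m t u :
  `|level m t - level m u| <= q ^+ m * (2 ^+ m * `|t - u|).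
Proof.
rewrite !levelE -mulrBr normrM (ger0_norm (root_halfX_ge0 m)).
rewrite ler_wpM2l ?root_halfX_ge0 //.
have -> : 2 ^+ m * `|t - u| = `|2 ^+ m * t - 2 ^+ m * u|.
  by rewrite -mulrBr normrM ger0_norm // exprn_ge0.
apply: le_trans (sum_tent_lipschitz (2 ^ m) _ _).
rewrite -sumrB; apply: le_trans (ler_norm_sum _ _ _) _.
apply: ler_sum => k _; rewrite -mulrBr normrM.
by rewrite ler_piMl // normr_ge0.
Qed.

(** The geometric mean of the two preceding bounds does not depend on the
    level: every level is [1/2]-Hoelder with the same constant. *)
Lemma level_holder m t u h : 0 <= h -> `|t - u| <= h ^+ 2 ->
  `|level m t - level m u| <= h.
Proof.
move=> h_ge0 tu_le.
rewrite -ler_sqr ?nnegrE //; set d := `|_|.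
have d_ge0 : 0 <= d by exact: normr_ge0.
have d1 : d <= q ^+ m.
  apply: le_trans (ler_normB _ _) _; rewrite [leRHS]splitr.
  by apply: lerD; exact: level_le.
have d2 := level_lipschitz m t u; rewrite -/d in d2.
apply: le_trans tu_le; rewrite -[leRHS]mul1r -(root_halfX2 m) expr2.
rewrite -!mulrA; apply: (le_trans (ler_pM d_ge0 d_ge0 d1 d2)).
by rewrite !mulrA.
Qed.

Lemma partial_holder M t u h : 0 <= h -> `|t - u| <= h ^+ 2 ->
  `|partial M t - partial M u| <= M%:R * h.
Proof.
move=> h_ge0 tu_le; rewrite -sumrB.
apply: le_trans (ler_norm_sum _ _ _) _.
rewrite mulr_natl -[M in leRHS]subn0 -sumr_const_nat.
by apply: ler_sum => m _; exact: level_holder.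
Qed.

Lemma sum_root_half M N : (M <= N)%N ->
  \sum_(M <= m < N) q ^+ m = (q ^+ M - q ^+ N) / (1 - q).
Proof.
move=> le_MN; have q1 : 1 - q != 0 by rewrite subr_eq0 gt_eqF // root_half_lt1.
elim: N le_MN => [|N IH].
  by rewrite leqn0 => /eqP->; rewrite big_geq // subrr mul0r.
rewrite leq_eqVlt => /orP[/eqP->|le_MN].
  by rewrite big_geq // subrr mul0r.
by rewrite big_nat_recr //= IH // exprS; field.
Qed.

Lemma partial_tail M N t : (M <= N)%N ->
  `|partial N t - partial M t| <= 2 * q ^+ M.
Proof.
move=> le_MN; rewrite /partial (big_cat_nat (leq0n M) le_MN) //=.
rewrite addrAC subrr add0r.
apply: le_trans (ler_norm_sum _ _ _) _.
apply: (@le_trans _ _ (\sum_(M <= m < N) q ^+ m / 2)).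
  by apply: ler_sum => m _; exact: level_le.
rewrite -mulr_suml sum_root_half //.
have qM := root_halfX_ge0 M; have qN := root_halfX_ge0 N.
have q_lt : q <= 3 / 4.
  by have := root_half2; have := root_half_gt0; nra.
rewrite -mulrA -invfM ler_pdivrMr; nra.
Qed.

Lemma partial_le M t : `|partial M t| <= 2.
Proof.
have := partial_tail t (leq0n M).
by rewrite {2}/partial big_geq // subr0 expr0 mulr1.
Qed.

Lemma partial_cvg t :
  partial^~ t @ \oo --> faber_schauder_series c t.
Proof.
have -> : partial^~ t = series (level^~ t) by [].
apply: (normed_cvg (V := R^o)).
apply: (series_le_cvg (v_ := geometric (1 / 2) q)).
- by move=> m; exact: normr_ge0.
- move=> m; rewrite /geometric /= mulr_ge0 ?exprn_ge0 //.
  exact/ltW/root_half_gt0.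
- by move=> m /=; rewrite div1r mulrC level_le.
apply: is_cvg_geometric_series.
by rewrite ger0_norm ?root_half_lt1 // ltW // root_half_gt0.
Qed.

Lemma series_tail M t :
  `|faber_schauder_series c t - partial M t| <= 2 * q ^+ M.
Proof.
have dist_cvg : (fun N => `|partial N t - partial M t|) @ \oo -->
                `|faber_schauder_series c t - partial M t|.
  by apply: cvg_norm; apply: cvgB; [exact: partial_cvg|exact: cvg_cst].
apply: cvgr_to_le dist_cvg _.
by exists M => // N /= le_MN; exact: partial_tail.
Qed.

Lemma series_le t : `|faber_schauder_series c t| <= 2.
Proof.
have := series_tail 0 t.
by rewrite /partial big_geq // subr0 expr0 mulr1.
Qed.

End Levels.

(** * Quadratic sums on uniform grids *)

Section Energy.
Variable R : realType.
Implicit Types (x y : R -> R) (m k n N M : nat).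
Local Notation q := (root_half R).

Definition energy N x : R :=
  \sum_(0 <= j < N) (x (j.+1%:R / N%:R) - x (j%:R / N%:R)) ^+ 2.

Lemma quadratic_sum_uniform N x :
  quadratic_sum x (uniform_grid R N) = energy N x.
Proof.
rewrite /quadratic_sum.
have -> : (size (uniform_grid R N)).-1 = N by rewrite size_map size_iota.
apply: eq_big_nat => j /andP[_ lt_jN].
rewrite !(nth_map 0%N) ?size_iota ?ltnS // 1?ltnW //.
by rewrite !nth_iota ?ltnS // 1?ltnW.
Qed.

Lemma energy_dist N x y A : 0 <= A ->
  (forall j, `|x (j%:R / N%:R) - y (j%:R / N%:R)| <= A) ->
  (forall t, `|x t| <= 2) -> (forall t, `|y t| <= 2) ->
  `|energy N x - energy N y| <= N%:R * (16 * A).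
Proof.
move=> A_ge0 xy x_le y_le; rewrite -sumrB.
apply: le_trans (ler_norm_sum _ _ _) _.
rewrite mulr_natl -[N in leRHS]subn0 -sumr_const_nat.
apply: ler_sum => j _; rewrite subr_sqr normrM [16 * A]mulrC.
have -> : A * 16 = (A + A) * (2 + 2 + 2 + 2) by ring.
apply: ler_pM => //.
  set a := x _; set b := x _; set c := y _; set d := y _.
  have -> : a - b - (c - d) = (a - c) - (b - d) by ring.
  by apply: le_trans (ler_normB _ _) _; apply: lerD; exact: xy.
apply: le_trans (ler_normD _ _) _; rewrite -addrA.
by apply: lerD; apply: le_trans (ler_normB _ _) _; apply: lerD.
Qed.

Lemma sum_nat_double n (F : nat -> R) :
  \sum_(0 <= j < 2 * n) F j =
  \sum_(0 <= k < n) (F (2 * k)%N + F (2 * k).+1).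
Proof.
elim: n => [|n IH]; first by rewrite !big_geq.
by rewrite mulnS [in RHS]big_nat_recr //= -IH !big_nat_recr //= addrA.
Qed.

Lemma sum_nat_triple n (F : nat -> R) :
  \sum_(0 <= j < 3 * n) F j =
  \sum_(0 <= k < n) (F (3 * k)%N + F (3 * k).+1 + F (3 * k).+2).
Proof.
elim: n => [|n IH]; first by rewrite !big_geq.
by rewrite mulnS [in RHS]big_nat_recr //= -IH !big_nat_recr //= !addrA.
Qed.

Lemma level_midpoint (c : forall m, 'I_(2 ^ m) -> R) n (k : 'I_(2 ^ n)) :
  level c n ((k%:R + 1 / 2) / 2 ^+ n) = q ^+ n * c n k / 2.
Proof.
have n2 : (2 : R) ^+ n != 0 by rewrite expf_neq0 // pnatr_eq0.
rewrite levelE (bigD1 k) //= big1 => [|i neq_ik].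
  rewrite addr0; have -> : 2 ^+ n * ((k%:R + 1 / 2) / 2 ^+ n) - k%:R = 1 / 2 :> R.
    by field.
  by case: tentP => *; rewrite -mulrA; congr (_ * (_ * _)); lra.
have -> : 2 ^+ n * ((k%:R + 1 / 2) / 2 ^+ n) = k%:R + 1 / 2 :> R by field.
have := neq_ik; rewrite -(inj_eq val_inj) /= neq_ltn => /orP[] lt_ik.
  rewrite tent_right ?mulr0 //.
  by move: lt_ik; rewrite -(ler_nat R) -natr1; lra.
rewrite tent_left ?mulr0 //.
by move: lt_ik; rewrite -(ler_nat R) -natr1; lra.
Qed.

(** Refining the dyadic grid splits every increment [D] into
    [D / 2 + e] and [D / 2 - e] with [e ^+ 2 = 2 ^- n / 4], whatever the sign
    attached to the midpoint. *)
Lemma energy_dyadic_partial (c : forall m, 'I_(2 ^ m) -> R) n :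
  (forall m (k : 'I_(2 ^ m)), c m k = 1 \/ c m k = -1) ->
  energy (2 ^ n) (partial c n) = 1 - 2 ^- n.
Proof.
move=> c_sign; elim: n => [|n IH].
  rewrite /energy /partial expn0 big_nat1 !big_geq //.
  by rewrite subrr expr0n expr0 invr1 subrr.
have n2 : (2 : R) ^+ n != 0 by rewrite expf_neq0 // pnatr_eq0.
have -> : energy (2 ^ n.+1) (partial c n.+1) =
    \sum_(0 <= k < 2 ^ n) ((partial c n (k.+1%:R / (2 ^ n)%:R)
      - partial c n (k%:R / (2 ^ n)%:R)) ^+ 2 / 2 + 2 ^- n / 2).
  rewrite /energy expnS sum_nat_double; apply: eq_big_nat => k /andP[_ lt_k].
  have e0 : (2 * k)%:R / (2 * 2 ^ n)%:R = k%:R / 2 ^+ n :> R.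
    by rewrite !natrM natrX; field.
  have e1 : (2 * k).+1%:R / (2 * 2 ^ n)%:R = (k%:R + 1 / 2) / 2 ^+ n :> R.
    by rewrite -natr1 !natrM natrX; field.
  have e2 : (2 * k).+2%:R / (2 * 2 ^ n)%:R = k.+1%:R / 2 ^+ n :> R.
    have -> : (2 * k).+2 = (2 * k.+1)%N by lia.
    by rewrite !natrM natrX; field.
  rewrite e0 e1 e2 !(partial_dyadic _ _ (leqnSn n)) natrX !partialS.
  rewrite (level_midpoint c (Ordinal lt_k)) partial_affine; last lra.
  set a := partial _ _ _; set b := partial _ _ _.
  have -> : (2 : R) ^- n = (q ^+ n * c n (Ordinal lt_k)) ^+ 2.
    rewrite exprMn -exprM mulnC exprM root_half2 div1r exprVn.
    by case: (c_sign n (Ordinal lt_k)) => ->; rewrite ?sqrrN expr1n mulr1.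
  by field.
rewrite big_split /= -mulr_suml -/(energy (2 ^ n) (partial c n)) IH.
rewrite sumr_const_nat subn0 -[X in _ + X]mulr_natl natrX exprS; field.
by rewrite n2.
Qed.

Lemma energy_dyadic (c : forall m, 'I_(2 ^ m) -> R) n :
  (forall m (k : 'I_(2 ^ m)), c m k = 1 \/ c m k = -1) ->
  energy (2 ^ n) (faber_schauder_series c) = 1 - 2 ^- n.
Proof.
move=> c_sign; rewrite -(energy_dyadic_partial n c_sign).
have seriesE k : faber_schauder_series c (k%:R / 2 ^+ n) =
                 partial c n (k%:R / 2 ^+ n).
  apply: cvg_lim; first exact: Rhausdorff.
  apply: cvg_near_cst; exists n => // M /= le_nM.
  exact: partial_dyadic.
by apply: eq_bigr => j _; rewrite !natrX !seriesE.
Qed.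

End Energy.

(** * Concentration on a finite product of biased signs *)

Section BiasedCube.
Variables (R : realFieldType) (I : finType) (p : R).
Implicit Types (s t : {ffun I -> bool}) (a i : I) (f : {ffun I -> bool} -> R).

Definition bernoulli_weight (v : bool) : R := if v then p else 1 - p.

Definition cube_weight s : R := \prod_i bernoulli_weight (s i).

Definition cube_mean f : R := \sum_s cube_weight s * f s.

Definition spin (v : bool) : R := if v then 1 else -1.

Definition update s a v : {ffun I -> bool} :=
  [ffun i => if i == a then v else s i].

(** The conditional mean of [f] given all coordinates but [a]. *)
Definition average a f s : R :=
  p * f (update s a true) + (1 - p) * f (update s a false).

Lemma cube_mean_prod (g : I -> bool -> R) :
  cube_mean (fun s => \prod_i g i (s i)) =
  \prod_i (p * g i true + (1 - p) * g i false).
Proof.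
transitivity (\sum_(s : {ffun I -> bool})
    \prod_i (bernoulli_weight (s i) * g i (s i))).
  by apply: eq_bigr => s _; rewrite big_split.
rewrite -(bigA_distr_bigA (fun i v => bernoulli_weight v * g i v)).
by apply: eq_bigr => i _; rewrite big_bool.
Qed.

Lemma cube_mean1 : cube_mean (fun=> 1) = 1.
Proof.
have -> : cube_mean (fun=> 1) = cube_mean (fun s => \prod_(i : I) 1).
  by apply: eq_bigr => s _; rewrite big1.
by rewrite (cube_mean_prod (fun _ _ => 1)) big1 // => i _; ring.
Qed.

Lemma cube_meanD f g :
  cube_mean (fun s => f s + g s) = cube_mean f + cube_mean g.
Proof. by rewrite -big_split; apply: eq_bigr => s _ /=; rewrite mulrDr. Qed.

Lemma cube_meanZ c f : cube_mean (fun s => c * f s) = c * cube_mean f.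
Proof. by rewrite mulr_sumr; apply: eq_bigr => s _; rewrite mulrCA. Qed.

Lemma cube_mean_sum (J : finType) (F : J -> {ffun I -> bool} -> R) :
  cube_mean (fun s => \sum_j F j s) = \sum_j cube_mean (F j).
Proof.
by rewrite exchange_big; apply: eq_bigr => s _; rewrite mulr_sumr.
Qed.

Lemma cube_mean_sum_nat n (F : nat -> {ffun I -> bool} -> R) :
  cube_mean (fun s => \sum_(0 <= j < n) F j s) =
  \sum_(0 <= j < n) cube_mean (F j).
Proof.
rewrite big_mkord -cube_mean_sum.
by apply: eq_bigr => s _; rewrite big_mkord.
Qed.

Lemma cube_mean_spinM a c :
  cube_mean (fun s => spin (s a) * spin (s c)) =
  if a == c then 1 else (2 * p - 1) ^+ 2.
Proof.
case: eqP => [<-|/eqP neq_ac].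
  rewrite -cube_mean1; apply: eq_bigr => s _; congr (_ * _).
  by rewrite /spin; case: (s a); ring.
pose g i v := if (i == a) || (i == c) then spin v else 1.
have -> : cube_mean (fun s => spin (s a) * spin (s c)) =
          cube_mean (fun s => \prod_i g i (s i)).
  apply: eq_bigr => s _; congr (_ * _).
  rewrite (bigD1 a) //= (bigD1 c) 1?eq_sym //= /g !eqxx orbT /=.
  by rewrite big1 ?mulr1 // => i /andP[/negPf-> /negPf->].
rewrite cube_mean_prod (bigD1 a) //= (bigD1 c) 1?eq_sym //= /g !eqxx orbT /=.
rewrite big1 ?mulr1 => [|i /andP[/negPf-> /negPf->] /=]; last by ring.
by rewrite /spin; ring.
Qed.

(** The signs are uncorrelated after centring, and their squares equal 1: the
    off-diagonal terms of the square carry the factor [(2 p - 1) ^+ 2], the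
    diagonal ones the factor 1. *)
Lemma cube_mean_square (x : I -> R) :
  cube_mean (fun s => (\sum_i spin (s i) * x i) ^+ 2) =
  (2 * p - 1) ^+ 2 * (\sum_i x i) ^+ 2 +
  (1 - (2 * p - 1) ^+ 2) * \sum_i x i ^+ 2.
Proof.
have expand (y : I -> R) : (\sum_i y i) ^+ 2 = \sum_i \sum_j y i * y j.
  by rewrite expr2 mulr_suml; apply: eq_bigr => i _; rewrite mulr_sumr.
have -> : cube_mean (fun s => (\sum_i spin (s i) * x i) ^+ 2) =
    \sum_i \sum_j x i * x j * (if i == j then 1 else (2 * p - 1) ^+ 2).
  transitivity (cube_mean (fun s =>
      \sum_i \sum_j x i * x j * (spin (s i) * spin (s j)))).
    apply: eq_bigr => s _; rewrite expand; congr (_ * _).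
    by apply: eq_bigr => i _; apply: eq_bigr => j _; ring.
  rewrite cube_mean_sum; apply: eq_bigr => i _.
  rewrite cube_mean_sum; apply: eq_bigr => j _.
  by rewrite cube_meanZ cube_mean_spinM.
rewrite expand !mulr_sumr -big_split; apply: eq_bigr => i _ /=.
rewrite (bigD1 i) //= eqxx mulr_sumr [in RHS](bigD1 i) //=.
rewrite -addrA [X in _ = _ + X]addrC addrA; congr (_ + _); first by ring.
by apply: eq_bigr => j /negPf neq_ji; rewrite eq_sym neq_ji; ring.
Qed.

Lemma update_id s a : update s a (s a) = s.
Proof. by apply/ffunP => i; rewrite ffunE; case: eqP => [->|]. Qed.

Lemma update_update s a v w : update (update s a v) a w = update s a w.
Proof. by apply/ffunP => i; rewrite !ffunE; case: eqP. Qed.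

Lemma updateC s a c v w : a != c ->
  update (update s a v) c w = update (update s c w) a v.
Proof.
move=> neq_ac; apply/ffunP => i; rewrite !ffunE; case: (i =P c) => [->|//].
by rewrite eq_sym (negPf neq_ac).
Qed.

Lemma average_update a f s v : average a f (update s a v) = average a f s.
Proof. by rewrite /average !update_update. Qed.

(** Both means are sums over the pairs of configurations that differ exactly
    at [a]; on each such pair the two contributions agree. *)
Lemma cube_mean_average a f : cube_mean (average a f) = cube_mean f.
Proof.
pose flip s := update s a (~~ s a).
have flipK : involutive flip.
  move=> s; rewrite /flip update_update !ffunE eqxx negbK.
  exact: update_id.
have pairing (F : {ffun I -> bool} -> R) :
    cube_mean F *+ 2 =
    \sum_s (cube_weight s * F s + cube_weight (flip s) * F (flip s)).
  rewrite big_split mulr2n /=; congr (_ + _).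
  exact: (reindex_inj (inv_inj flipK)).
apply: (@mulIf _ 2%:R); first by rewrite pnatr_eq0.
rewrite !mulr_natr !pairing; apply: eq_bigr => s _.
have wE u : cube_weight u =
    bernoulli_weight (u a) * \prod_(i | i != a) bernoulli_weight (u i).
  by rewrite /cube_weight (bigD1 a).
rewrite !wE.
have -> : \prod_(i | i != a) bernoulli_weight (flip s i) =
          \prod_(i | i != a) bernoulli_weight (s i).
  by apply: eq_bigr => i /negPf neq_ia; rewrite ffunE neq_ia.
rewrite !average_update /average /flip ffunE eqxx.
have -> : f s = f (update s a (s a)) by rewrite update_id.
by case: (s a); rewrite /bernoulli_weight /=; ring.
Qed.

Hypothesis p01 : 0 <= p <= 1.

Lemma cube_weight_ge0 s : 0 <= cube_weight s.
Proof.
case/andP: p01 => p_ge0 p_le1; apply: prodr_ge0 => i _.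
by rewrite /bernoulli_weight; case: (s i) => //; rewrite subr_ge0.
Qed.

Lemma cube_mean_le f g : (forall s, f s <= g s) -> cube_mean f <= cube_mean g.
Proof.
by move=> le_fg; apply: ler_sum => s _; rewrite ler_wpM2l ?cube_weight_ge0.
Qed.

(** The coordinates on which [f] depends are those listed in [r]; they are
    averaged out one by one. Averaging out one coordinate costs the conditional
    variance [p (1 - p) (f (a := +) - f (a := -)) ^+ 2]; when no coordinate is
    left the function is constant. This is the Efron-Stein bound for functions
    of finitely many signs. *)
Lemma cube_variance_le (c : I -> R) (r : seq I) f :
  (forall s t, (forall i, i \in r -> s i = t i) -> f s = f t) ->
  (forall s a, `|f (update s a true) - f (update s a false)| <= c a) ->
  cube_mean (fun s => f s ^+ 2) - cube_mean f ^+ 2 <= \sum_(i <- r) c i ^+ 2.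
Proof.
elim: r f => [|a r IHr] f f_r f_c.
  pose s0 : {ffun I -> bool} := [ffun=> true].
  have fE s : f s = f s0 by exact: f_r.
  have -> : cube_mean f = f s0.
    rewrite -[RHS]mulr1 -cube_mean1 -cube_meanZ.
    by apply: eq_bigr => s _; rewrite fE mulr1.
  have -> : cube_mean (fun s => f s ^+ 2) = f s0 ^+ 2.
    rewrite -[RHS]mulr1 -cube_mean1 -cube_meanZ.
    by apply: eq_bigr => s _; rewrite fE mulr1.
  by rewrite subrr big_nil.
have := IHr (average a f); rewrite cube_mean_average big_cons => IH.
have {IH} : cube_mean (fun s => average a f s ^+ 2) - cube_mean f ^+ 2 <=
            \sum_(i <- r) c i ^+ 2.
  apply: IH => [s t st|s i].
    congr (_ * _ + _ * _); apply: f_r => i.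
      rewrite inE !ffunE; case: eqP => //= _; exact: st.
    rewrite inE !ffunE; case: eqP => //= _; exact: st.
  have [<-|neq_ai] := eqVneq a i.
    rewrite !average_update subrr normr0.
    by apply: le_trans (f_c s a); exact: normr_ge0.
  have neq_ia : i != a by rewrite eq_sym.
  rewrite /average !(updateC s _ _ neq_ia).
  have := f_c (update s a true) i; have := f_c (update s a false) i.
  case/andP: p01 => p_ge0 p_le1; rewrite !ler_norml.
  by move=> /andP[? ?] /andP[? ?]; apply/andP; split; nra.
suff : cube_mean (fun s => f s ^+ 2) <=
       cube_mean (fun s => average a f s ^+ 2) + c a ^+ 2 by lra.
rewrite -(cube_mean_average a (fun s => f s ^+ 2)).
rewrite -[c a ^+ 2]mulr1 -cube_mean1 -cube_meanZ -cube_meanD.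
apply: cube_mean_le => s; rewrite /average mulr1.
have := f_c s a; set x := f _; set y := f _ => xy.
have xyc : (x - y) ^+ 2 <= c a ^+ 2.
  rewrite -real_normK ?num_real // ler_sqr ?nnegrE //.
  by apply: le_trans xy; exact: normr_ge0.
have -> : p * x ^+ 2 + (1 - p) * y ^+ 2 =
  (p * x + (1 - p) * y) ^+ 2 + p * (1 - p) * (x - y) ^+ 2 by ring.
rewrite lerD2l; have := sqr_ge0 (x - y).
case/andP: p01 => p_ge0 p_le1.
have : p * (1 - p) <= 1 by nra.
nra.
Qed.

(** Chebyshev's inequality. The weights are left as a finite sum, so that the
    measure space of the signs only enters through the weight of single
    configurations. *)
Lemma cube_chebyshev (c : I -> R) f (e : R) : 0 < e ->
  (forall s a, `|f (update s a true) - f (update s a false)| <= c a) ->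
  \sum_(s : {ffun I -> bool} | e < `|f s - cube_mean f|) cube_weight s <=
  (\sum_i c i ^+ 2) / e ^+ 2.
Proof.
move=> e_gt0 f_c.
have e2_gt0 : 0 < e ^+ 2 by rewrite exprn_gt0.
rewrite ler_pdivlMr //.
have var : cube_mean (fun s => f s ^+ 2) - cube_mean f ^+ 2 <= \sum_i c i ^+ 2.
  rewrite -big_enum /=; apply: cube_variance_le => // s t st.
  by congr f; apply/ffunP => i; apply: st; rewrite mem_enum.
apply: le_trans var.
have -> : cube_mean (fun s => f s ^+ 2) - cube_mean f ^+ 2 =
          cube_mean (fun s => (f s - cube_mean f) ^+ 2).
  set m := cube_mean f.
  transitivity (cube_mean (fun s => f s ^+ 2 + (- (2 * m) * f s + m ^+ 2 * 1))).
    by rewrite !cube_meanD !cube_meanZ cube_mean1 -/m; ring.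
  by apply: eq_bigr => s _; congr (_ * _); ring.
rewrite big_mkcond mulr_suml; apply: ler_sum => s _.
case: ifP => [lt_e|_]; last first.
  by rewrite mul0r mulr_ge0 ?cube_weight_ge0 ?sqr_ge0.
rewrite ler_wpM2l ?cube_weight_ge0 //.
rewrite -[leRHS]real_normK ?num_real // ler_sqr ?nnegrE ?normr_ge0 //; lra.
Qed.

End BiasedCube.

(** * Parseval's identity for the Schauder functions *)

Section Parseval.
Variable R : realType.
Implicit Types (s t : R) (m k n N M : nat).
Local Notation q := (root_half R).

(** The partial sums of the Levy-Ciesielski expansion of the covariance of the
    Brownian bridge. *)
Definition kernel M s t : R := \sum_(0 <= m < M)
  2 ^- m * \sum_(k < 2 ^ m) tent (2 ^+ m * s - k%:R) * tent (2 ^+ m * t - k%:R).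

(** The two halves of the unit interval carry scaled copies of the system. *)
Lemma kernelS M s t : kernel M.+1 s t = tent s * tent t +
  (kernel M (2 * s) (2 * t) + kernel M (2 * s - 1) (2 * t - 1)) / 2.
Proof.
rewrite /kernel big_nat_recl // expr0 invr1 mul1r.
rewrite expn0 big_ord1 !mul1r !subr0; congr (_ + _).
rewrite -big_split mulr_suml; apply: eq_bigr => m _ /=.
rewrite -mulrDr mulrAC -invfM -exprSr expnS mul2n -addnn big_split_ord /=.
congr (_ * (_ + _)); apply: eq_bigr => k _;
by congr (tent _ * tent _); rewrite ?natrD ?natrX exprS; ring.
Qed.

Lemma kernel_left M s t : s <= 0 -> kernel M s t = 0.
Proof.
move=> s_le0; rewrite /kernel big1 // => m _; rewrite big1 ?mulr0 // => k _.
rewrite tent_left ?mul0r // subr_le0; apply: (@le_trans _ _ 0) => //.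
by rewrite mulr_ge0_le0 ?exprn_ge0.
Qed.

Lemma kernel_right M s t : 1 <= t -> kernel M s t = 0.
Proof.
move=> t_ge1; rewrite /kernel big1 // => m _; rewrite big1 ?mulr0 // => k _.
rewrite [X in _ * X]tent_right ?mulr0 // lerBrDr nat1r.
apply: (@le_trans _ _ (2 ^+ m)); first by rewrite -natrX ler_nat.
by rewrite ler_peMr ?exprn_ge0.
Qed.

(** The covariance of the Brownian bridge, extended by zero. *)
Definition bridge s t : R := clamp 1 s * (1 - clamp 1 t).

Lemma bridge_left s t : s <= 0 -> bridge s t = 0.
Proof.
move=> s_le0; rewrite /bridge.
have -> : clamp 1 s = 0 by case: (clampP s ler01) => *; lra.
exact: mul0r.
Qed.

Lemma bridge_right s t : 1 <= t -> bridge s t = 0.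
Proof.
move=> t_ge1; rewrite /bridge.
have -> : clamp 1 t = 1 by case: (clampP t ler01) => *; lra.
by rewrite subrr mulr0.
Qed.

(** Conditionally on its midpoint, the Brownian bridge splits into two
    independent bridges at half scale: its covariance satisfies the same
    self-similarity as the kernels. *)
Lemma bridgeS s t : s <= t -> bridge s t = tent s * tent t +
  (bridge (2 * s) (2 * t) + bridge (2 * s - 1) (2 * t - 1)) / 2.
Proof.
have clamps (u : R) : [\/ [/\ u <= 0, tent u = 0, clamp 1 u = 0,
      clamp 1 (2 * u) = 0 & clamp 1 (2 * u - 1) = 0],
    [/\ 0 <= u <= 1 / 2, tent u = u, clamp 1 u = u,
      clamp 1 (2 * u) = 2 * u & clamp 1 (2 * u - 1) = 0],
    [/\ 1 / 2 <= u <= 1, tent u = 1 - u, clamp 1 u = u,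
      clamp 1 (2 * u) = 1 & clamp 1 (2 * u - 1) = 2 * u - 1] |
    [/\ 1 <= u, tent u = 0, clamp 1 u = 1,
      clamp 1 (2 * u) = 1 & clamp 1 (2 * u - 1) = 1]].
  case: tentP => *.
  - constructor 1; split=> //.
    + by case: (clampP u ler01) => *; lra.
    + by case: (clampP (2 * u) ler01) => *; lra.
    + by case: (clampP (2 * u - 1) ler01) => *; lra.
  - constructor 2; split=> //; first exact/andP.
    + by case: (clampP u ler01) => *; lra.
    + by case: (clampP (2 * u) ler01) => *; lra.
    + by case: (clampP (2 * u - 1) ler01) => *; lra.
  - constructor 3; split=> //; first exact/andP.
    + by case: (clampP u ler01) => *; lra.
    + by case: (clampP (2 * u) ler01) => *; lra.
    + by case: (clampP (2 * u - 1) ler01) => *; lra.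
  - constructor 4; split=> //.
    + by case: (clampP u ler01) => *; lra.
    + by case: (clampP (2 * u) ler01) => *; lra.
    + by case: (clampP (2 * u - 1) ler01) => *; lra.
move=> le_st; rewrite /bridge.
case: (clamps s) => [][? -> -> -> ->]; case: (clamps t) => [][? -> -> -> ->];
  first [lra | nra].
Qed.

(** The remainders on the two halves have disjoint supports, hence the error
    is halved at every level. *)
Lemma kernel_bridge M s t : s <= t -> `|bridge s t - kernel M s t| <= 2 ^- M.
Proof.
elim: M s t => [|M IH] s t le_st.
  rewrite /kernel big_geq // subr0 expr0 invr1 /bridge.
  have := clamp_bounds s ler01; have := clamp_bounds t ler01.
  move=> /andP[? ?] /andP[? ?].
  by rewrite ler_norml; apply/andP; split; nra.
rewrite bridgeS // kernelS.
have -> (a b c d e : R) : a + (b + c) / 2 - (a + (d + e) / 2) =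
  ((b - d) + (c - e)) / 2 by lra.
have half (x : R) : x <= 2 ^- M -> x / 2 <= 2 ^- M.+1.
  by rewrite exprS invfM mulrC => ?; rewrite ler_pM2l.
rewrite normrM normfV normr_nat; apply: half.
have [t_le|t_gt] := leP t (1 / 2).
  have s_le : 2 * s - 1 <= 0 by lra.
  rewrite (bridge_left _ s_le) (kernel_left _ _ s_le).
  by rewrite subrr addr0; apply: IH; lra.
have t_ge : 1 <= 2 * t by lra.
rewrite (bridge_right _ t_ge) (kernel_right _ _ t_ge).
by rewrite subrr add0r; apply: IH; lra.
Qed.

Lemma kernelE M s t : kernel M s t = \sum_(0 <= m < M) \sum_(k < 2 ^ m)
  faber_schauder m k s * faber_schauder m k t.
Proof.
apply: eq_bigr => m _; rewrite mulr_sumr; apply: eq_bigr => k _.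
rewrite !faber_schauderE mulrACA -expr2 -exprM mulnC exprM root_half2.
by rewrite div1r exprVn.
Qed.

Definition schauder_increments M s t : R := \sum_(0 <= m < M) \sum_(k < 2 ^ m)
  (faber_schauder m k t - faber_schauder m k s) ^+ 2.

(** The variance of the increment of the Brownian bridge between [s] and [t] is
    [(t - s) - (t - s) ^+ 2]. *)
Lemma schauder_parseval M s t : 0 <= s -> s <= t -> t <= 1 ->
  `|schauder_increments M s t - ((t - s) - (t - s) ^+ 2)| <= 4 * 2 ^- M.
Proof.
move=> s_ge0 le_st t_le1.
have -> : schauder_increments M s t =
    kernel M t t - 2 * kernel M s t + kernel M s s.
  rewrite !kernelE mulr_sumr -sumrB -big_split; apply: eq_bigr => m _ /=.
  rewrite mulr_sumr -sumrB -big_split; apply: eq_bigr => k _ /=; ring.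
have cl u : 0 <= u <= 1 -> clamp 1 u = u.
  by move=> ?; case: (clampP u ler01) => *; lra.
have := kernel_bridge M le_st.
have := kernel_bridge M (lexx s); have := kernel_bridge M (lexx t).
rewrite /bridge !cl ?ler_norml; [|lra|lra].
move=> /andP[? ?] /andP[? ?] /andP[? ?]; apply/andP; split; lra.
Qed.

Lemma sum_schauder_increments M N : (0 < N)%N ->
  `|\sum_(0 <= j < N) schauder_increments M (j%:R / N%:R) (j.+1%:R / N%:R)
    - (1 - N%:R^-1)| <= N%:R * (4 * 2 ^- M).
Proof.
move=> N_gt0; have NR_gt0 : 0 < N%:R :> R by rewrite ltr0n.
have N_neq0 := lt0r_neq0 NR_gt0.
have -> : 1 - N%:R^-1 =
    \sum_(0 <= j < N) (N%:R^-1 - N%:R^-1 ^+ 2) :> R.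
  by rewrite sumr_const_nat subn0 -[RHS]mulr_natl; field.
rewrite -sumrB; apply: le_trans (ler_norm_sum _ _ _) _.
rewrite mulr_natl -[N in leRHS]subn0 -sumr_const_nat.
rewrite big_nat [leRHS]big_nat; apply: ler_sum => j /andP[_ lt_jN].
have dE : N%:R^-1 = j.+1%:R / N%:R - j%:R / N%:R :> R.
  by rewrite -natr1; field.
rewrite [X in X - X ^+ 2]dE; apply: schauder_parseval.
- by rewrite divr_ge0.
- by rewrite -subr_ge0 -dE invr_ge0 ltW.
- by rewrite ler_pdivrMr // mul1r ler_nat.
Qed.

End Parseval.

(** * Mean and fluctuations of quadratic sums of random signs *)

Section RandomEnergy.
Variables (R : realType) (M : nat).
Implicit Types (t : R) (m k n N : nat).
Local Notation q := (root_half R).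

Local Notation node := {m : 'I_M & 'I_(2 ^ m)}.

(** The value 1 beyond level [M] is a default: it turns a configuration into a
    full family of coefficients, of which only the first [M] levels are used. *)
Definition signs (s : {ffun node -> bool}) m (k : 'I_(2 ^ m)) : R :=
  if @idP (m < M)%N is ReflectT lt_mM then
    spin R (s (existT (fun m : 'I_M => 'I_(2 ^ m)) (Ordinal lt_mM) k))
  else 1.

Lemma signsE s (a : node) : signs s (tagged a) = spin R (s a).
Proof.
case: a => [[m lt'_mM] k]; rewrite /signs /=.
case: {-}_ / idP => [lt_mM|//].
by rewrite (bool_irrelevance lt_mM lt'_mM).
Qed.

Lemma signs_le1 s m (k : 'I_(2 ^ m)) : `|signs s k| <= 1.
Proof.
rewrite /signs /spin; case: {-}_ / idP => [?|_]; last by rewrite normr1.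
by case: (s _); rewrite ?normrN normr1.
Qed.

Lemma sum_nodes (F : forall m, 'I_(2 ^ m) -> R) :
  \sum_(0 <= m < M) \sum_(k < 2 ^ m) F m k = \sum_(a : node) F _ (tagged a).
Proof.
rewrite big_mkord.
exact: (@sig_big_dep _ _ _ _ (fun m : 'I_M => 'I_(2 ^ m)) xpredT
  (fun _ => xpredT) (fun (m : 'I_M) (k : 'I_(2 ^ m)) => F m k)).
Qed.

Lemma partial_nodes (c : forall m, 'I_(2 ^ m) -> R) t : partial c M t =
  \sum_(a : node) c (tag a) (tagged a) * faber_schauder (tag a) (tagged a) t.
Proof. exact: (sum_nodes (fun m i => c m i * faber_schauder m i t)). Qed.

Lemma partial_signsE s t : partial (signs s) M t =
  \sum_(a : node) spin R (s a) * faber_schauder (tag a) (tagged a) t.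
Proof. by rewrite partial_nodes; apply: eq_bigr => a _; rewrite signsE. Qed.

Variable p : R.
Let b : R := 2 * p - 1.

(** The energy is a sum of squares of linear forms in the signs, so its mean
    separates into the energy of the mean path and a variance to which
    Parseval's identity applies. *)
Lemma mean_energy N :
  cube_mean p (fun s => energy N (partial (signs s) M)) =
  b ^+ 2 * energy N (partial (fun _ _ => 1) M) + (1 - b ^+ 2) *
  \sum_(0 <= j < N) schauder_increments M (j%:R / N%:R) (j.+1%:R / N%:R).
Proof.
rewrite cube_mean_sum_nat !mulr_sumr -big_split; apply: eq_bigr => j _ /=.
pose x (a : node) := faber_schauder (tag a) (tagged a) (j.+1%:R / N%:R) -
                     faber_schauder (tag a) (tagged a) (j%:R / N%:R) : R.
transitivity (cube_mean p (fun s => (\sum_a spin R (s a) * x a) ^+ 2)).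
  apply: eq_bigr => s _; rewrite !partial_signsE -sumrB; congr (_ * _ ^+ 2).
  by apply: eq_bigr => a _; rewrite mulrBr.
rewrite cube_mean_square /schauder_increments.
rewrite (sum_nodes (fun m i => (faber_schauder m i _ - _) ^+ 2)).
congr (_ * _ ^+ 2 + _); rewrite /partial -sumrB.
under [RHS]eq_bigr do rewrite -sumrB.
rewrite (sum_nodes (fun m i => 1 * faber_schauder m i _ - 1 * _)).
by apply: eq_bigr => a _; rewrite !mul1r.
Qed.

(** Reversing one sign moves the path by twice a Schauder function, whose total
    variation is at most [q ^+ m]; the other factor of the difference of
    squares is controlled by the Hoelder bound. *)
Lemma energy_update N (h : R) s (a : node) : 0 <= h -> h ^+ 2 = N%:R^-1 ->
  `|energy N (partial (signs (update s a true)) M) -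
    energy N (partial (signs (update s a false)) M)|
    <= 4 * M%:R * h * q ^+ tag a.
Proof.
move=> h_ge0 h2; rewrite -sumrB; apply: le_trans (ler_norm_sum _ _ _) _.
pose e t := faber_schauder (tag a) (tagged a) t : R.
have diff t : partial (signs (update s a true)) M t -
    partial (signs (update s a false)) M t = 2 * e t.
  rewrite !partial_signsE -sumrB (bigD1 a) //= big1 => [|c neq_ca].
    by rewrite !ffunE eqxx /spin -/(e t); ring.
  by rewrite !ffunE (negPf neq_ca) subrr.
apply: (@le_trans _ _ (\sum_(0 <= j < N) 4 * M%:R * h *
    `|e (j.+1%:R / N%:R) - e (j%:R / N%:R)|)).
  rewrite big_nat [leRHS]big_nat; apply: ler_sum => j /andP[_ lt_jN].
  have N_neq0 : N%:R != 0 :> R by rewrite pnatr_eq0 -lt0n (leq_trans _ lt_jN).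
  have step : `|j.+1%:R / N%:R - j%:R / N%:R| <= h ^+ 2 :> R.
    have -> : j.+1%:R / N%:R - j%:R / N%:R = N%:R^-1 :> R.
      by rewrite -natr1; field.
    by rewrite h2 ger0_norm // invr_ge0.
  have hold v := partial_holder (signs_le1 (update s a v)) M h_ge0 step.
  have dist1 := hold true; have dist0 := hold false.
  have d1 := diff (j.+1%:R / N%:R); have d0 := diff (j%:R / N%:R).
  move: d0 d1 dist0 dist1.
  move: (partial (signs (update s a true)) M (j.+1%:R / N%:R))
    (partial (signs (update s a true)) M (j%:R / N%:R))
    (partial (signs (update s a false)) M (j.+1%:R / N%:R))
    (partial (signs (update s a false)) M (j%:R / N%:R)).
  move=> x1 x0 y1 y0 d0 d1 dist0 dist1.
  rewrite subr_sqr normrM.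
  have -> : x1 - x0 - (y1 - y0) =
      2 * (e (j.+1%:R / N%:R) - e (j%:R / N%:R)).
    by rewrite mulrBr -d0 -d1; ring.
  rewrite normrM normr_nat.
  have -> : 4 * M%:R * h * `|e (j.+1%:R / N%:R) - e (j%:R / N%:R)| =
    2 * `|e (j.+1%:R / N%:R) - e (j%:R / N%:R)| * (M%:R * h + M%:R * h).
    by ring.
  rewrite ler_wpM2l ?mulr_ge0 //.
  by apply: le_trans (ler_normD _ _) _; exact: lerD dist1 dist0.
rewrite -mulr_sumr ler_wpM2l ?mulr_ge0 //.
rewrite -[leRHS]mulr1.
apply: (@le_trans _ _ (q ^+ tag a * \sum_(0 <= j < N)
  `|tent (2 ^+ tag a * (j.+1%:R / N%:R) - (tagged a)%:R) -
    tent (2 ^+ tag a * (j%:R / N%:R) - (tagged a)%:R)|)).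
  rewrite mulr_sumr; apply: ler_sum => j _.
  rewrite /e !faber_schauderE -mulrBr normrM.
  by rewrite (ger0_norm (root_halfX_ge0 _ _)).
rewrite ler_wpM2l ?root_halfX_ge0 //; apply: (tent_variation
  (u := fun j => 2 ^+ tag a * (j%:R / N%:R) - (tagged a)%:R)) => j.
by rewrite lerD2r ler_wpM2l ?exprn_ge0 // ler_wpM2r ?invr_ge0 ?ler_nat.
Qed.

(** A level contains [2 ^ m] signs, and the squared effect of each of them is
    [16 M ^+ 2 2 ^- m / N]: every level contributes [16 M ^+ 2 / N] to the
    variance. *)
Lemma energy_concentration N (e : R) : 0 <= p <= 1 -> (0 < N)%N -> 0 < e ->
  \sum_(s : {ffun node -> bool} |
        e < `|energy N (partial (signs s) M) -
              cube_mean p (fun s => energy N (partial (signs s) M))|)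
    cube_weight p s <= 16 * M%:R ^+ 3 / N%:R / e ^+ 2.
Proof.
move=> p01 N_gt0 e_gt0; pose h : R := Num.sqrt N%:R^-1.
have h_ge0 : 0 <= h by exact: sqrtr_ge0.
have h2 : h ^+ 2 = N%:R^-1 by rewrite sqr_sqrtr // invr_ge0.
have := cube_chebyshev (f := fun s => energy N (partial (signs s) M))
  p01 e_gt0 (fun s a => energy_update s a h_ge0 h2).
move/le_trans; apply; rewrite ler_pM2r ?invr_gt0 ?exprn_gt0 //.
rewrite -(sum_nodes (fun m _ => (4 * M%:R * h * q ^+ m) ^+ 2)).
rewrite (eq_bigr (fun=> 16 * M%:R ^+ 2 * h ^+ 2)) => [|m _].
  rewrite sumr_const_nat subn0 -mulr_natr h2 le_eqVlt; apply/orP; left.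
  by apply/eqP; ring.
rewrite sumr_const card_ord -[LHS]mulr_natr natrX -[RHS]mulr1.
rewrite -[X in _ = _ * X](root_halfX2 R m).
by ring.
Qed.

End RandomEnergy.

(** * The mean path and the thirds grids *)

Section MeanPath.
Variable R : realType.
Implicit Types (t : R) (m k n N M l d j : nat).
Local Notation q := (root_half R).

(** Up to the factor [2 nu - 1], the mean of the random path. *)
Definition takagi M : R -> R := partial (fun _ _ => 1) M.

Lemma sum_tent_cell K d (f : R) : 0 <= f <= 1 ->
  \sum_(k < K) tent (d%:R + f - k%:R) = if (d < K)%N then tent f else 0.
Proof.
move=> /andP[f_ge0 f_le1].
have far (k : nat) : k != d -> tent (d%:R + f - k%:R) = 0.
  rewrite neq_ltn => /orP[]; rewrite -(ler_nat R) -natr1 => ?.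
    by rewrite tent_right //; lra.
  by rewrite tent_left //; lra.
case: ifP => [lt_dK|ge_dK]; last first.
  by rewrite big1 // => k _; rewrite far //; move: ge_dK; case: k => /= *; lia.
rewrite (bigD1 (Ordinal lt_dK)) //= big1 ?addr0 => [|k neq_k].
  by congr tent; ring.
by rewrite far // -[d]/(val (Ordinal lt_dK)) (inj_eq val_inj).
Qed.

Lemma level_takagi m d (f t : R) : 0 <= f <= 1 -> 2 ^+ m * t = d%:R + f ->
  level (fun _ _ => 1) m t = q ^+ m * if (d < 2 ^ m)%N then tent f else 0.
Proof.
move=> f01 tE; rewrite levelE tE -sum_tent_cell //; congr (_ * _).
by apply: eq_bigr => k _; rewrite mul1r.
Qed.

(** A power of two times an integer prime to 3 is prime to 3: at the two
    interior third points of a dyadic cell, [2 ^ m * t] is at distance [1 / 3]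
    from the integers for all [m >= n]. *)
Lemma takagi_third n M k (r : nat) :
  (k < 2 ^ n)%N -> (n <= M)%N -> r \in [:: 1%N; 2] ->
  takagi M ((k%:R + r%:R / 3) / 2 ^+ n) =
  takagi n ((k%:R + r%:R / 3) / 2 ^+ n) + (q ^+ n - q ^+ M) / (1 - q) / 3.
Proof.
move=> lt_k le_nM r12.
rewrite {1}/takagi /partial (big_cat_nat (leq0n n) le_nM) //=; congr (_ + _).
rewrite -sum_root_half // mulr_suml; apply: eq_big_nat => m /andP[le_nm _].
pose x := (2 ^ (m - n) * (3 * k + r))%N.
have x_mod : ((x %% 3 == 1) || (x %% 3 == 2))%N.
  rewrite /x -modnMm.
  have : ((2 ^ (m - n) %% 3 == 1) || (2 ^ (m - n) %% 3 == 2))%N.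
    elim: (m - n)%N => // i; rewrite expnS -modnMmr => IH.
    by case/orP: IH => /eqP->.
  have -> : ((3 * k + r) %% 3 = r)%N.
    by rewrite mulnC modnMDl modn_small //; case/or3P: r12 => // /eqP->.
  by case/orP => /eqP->; case/or3P: r12 => // /eqP->.
have f01 : 0 <= ((x %% 3)%:R / 3 : R) <= 1.
  by case/orP: x_mod => /eqP->; lra.
rewrite (level_takagi (d := x %/ 3) f01); last first.
  have -> : 2 ^+ m * ((k%:R + r%:R / 3) / 2 ^+ n) = x%:R / 3 :> R.
    rewrite /x natrM natrX natrD natrM -{1}(subnKC le_nm) exprD; field.
    by rewrite expf_neq0 // pnatr_eq0.
  by rewrite {1}(divn_eq x 3) natrD natrM; field.
rewrite ifT; last first.
  rewrite ltn_divLR // /x -{2}(subnKC le_nm) expnD [(2 ^ n * _)%N]mulnC -mulnA.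
  by rewrite ltn_mul2l expn_gt0 /=; case/or3P: r12 => // /eqP->; lia.
congr (_ * _); have -> : tent ((x %% 3)%:R / 3) = 1 / 3 :> R.
  by case/orP: x_mod => /eqP->; case: tentP => *; lra.
exact: div1r.
Qed.

(** In a dyadic cell with increment [D] the three increments are [D / 3 + c],
    [D / 3] and [D / 3 - c]: the cross terms cancel. *)
Lemma energy_takagi_thirds n M : (n <= M)%N ->
  energy (3 * 2 ^ n) (takagi M) =
  (1 - 2 ^- n) / 3 + 2 / 9 * ((1 - q ^+ (M - n)) / (1 - q)) ^+ 2.
Proof.
move=> le_nM; have n2 : (2 : R) ^+ n != 0 by rewrite expf_neq0 // pnatr_eq0.
pose c := (q ^+ n - q ^+ M) / (1 - q) / 3.
pose D k : R := takagi n (k.+1%:R / 2 ^+ n) - takagi n (k%:R / 2 ^+ n).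
have -> : energy (3 * 2 ^ n) (takagi M) =
    \sum_(0 <= k < 2 ^ n) (D k ^+ 2 / 3 + 2 * c ^+ 2).
  rewrite /energy sum_nat_triple; apply: eq_big_nat => k /andP[_ lt_k].
  have e0 : (3 * k)%:R / (3 * 2 ^ n)%:R = k%:R / 2 ^+ n :> R.
    by rewrite !natrM natrX; field.
  have e1 : (3 * k).+1%:R / (3 * 2 ^ n)%:R = (k%:R + 1%:R / 3) / 2 ^+ n :> R.
    by rewrite -natr1 !natrM natrX; field.
  have e2 : (3 * k).+2%:R / (3 * 2 ^ n)%:R = (k%:R + 2%:R / 3) / 2 ^+ n :> R.
    by rewrite -addn2 natrD !natrM natrX; field.
  have e3 : (3 * k).+3%:R / (3 * 2 ^ n)%:R = k.+1%:R / 2 ^+ n :> R.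
    have -> : (3 * k).+3 = (3 * k.+1)%N by lia.
    by rewrite !natrM natrX; field.
  have third r := takagi_third (r := r) lt_k le_nM.
  rewrite e0 e1 e2 e3 (third 1%N isT) (third 2%N isT) -/c /D /takagi.
  rewrite !(partial_dyadic _ _ le_nM) !partial_affine; [|lra|lra].
  by set x := partial _ _ _; set y := partial _ _ _; field.
rewrite big_split /= -mulr_suml.
have -> : \sum_(0 <= k < 2 ^ n) D k ^+ 2 = 1 - 2 ^- n.
  rewrite -(energy_dyadic_partial n (c := fun _ _ => 1)); last by left.
  by apply: eq_bigr => k _; rewrite natrX.
congr (_ + _); rewrite sumr_const_nat subn0 -[LHS]mulr_natl natrX.
have -> : c = q ^+ n * ((1 - q ^+ (M - n)) / (1 - q) / 3).
  by rewrite /c -{1}(subnKC le_nM) exprD; ring.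
have := root_halfX2 R n; move: (q ^+ n) ((1 - _) / _) => u v uE.
rewrite exprMn expr_div_n.
transitivity (2 / 9 * v ^+ 2 * (u * u * 2 ^+ n)); first by field.
by rewrite uE mulr1.
Qed.

End MeanPath.

(** * Sums over the residues modulo an odd number *)

Section OddGrid.
Variable R : realFieldType.
Implicit Types (N H x y j c m k a : nat) (F : nat -> R).

(** The distance from [x / N] to the nearest integer. *)
Definition zigzag N x : R := (minn (x %% N) (N - x %% N))%:R / N%:R.

Lemma zigzag_mod N x y : x = y %[mod N] -> zigzag N x = zigzag N y.
Proof. by rewrite /zigzag => ->. Qed.

Lemma zigzagDl N x : zigzag N (x + N) = zigzag N x.
Proof. by apply: zigzag_mod; rewrite modnDr. Qed.

Lemma zigzag0 N : zigzag N 0 = 0.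
Proof. by rewrite /zigzag mod0n min0n mul0r. Qed.

Lemma zigzag_ge0 N x : 0 <= zigzag N x.
Proof. by rewrite divr_ge0. Qed.

Lemma zigzag_le N x : zigzag N x <= 1 / 2.
Proof.
have [->|N_gt0] := posnP N; first by rewrite /zigzag invr0 mulr0; lra.
rewrite /zigzag ler_pdivrMr ?ltr0n //.
have : (minn (x %% N) (N - x %% N) * 2 <= N)%N by lia.
by rewrite -(ler_nat R) natrM; lra.
Qed.

Lemma zigzag_diff_le N x y : `|zigzag N x - zigzag N y| <= 1 / 2.
Proof.
have := zigzag_ge0 N x; have := zigzag_ge0 N y.
have := zigzag_le N x; have := zigzag_le N y.
by rewrite ler_norml => *; apply/andP; split; lra.
Qed.

Lemma zigzag_lipschitz N x y : (0 < N)%N ->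
  `|zigzag N (x + y) - zigzag N x| <= y%:R / N%:R.
Proof.
move=> N_gt0; have NR_gt0 : 0 < N%:R :> R by rewrite ltr0n.
elim: y => [|y IH]; first by rewrite addn0 subrr normr0 mul0r.
rewrite -natr1 mulrDl -(subrKA (zigzag N (x + y))).
apply: le_trans (ler_normD _ _) _; rewrite addrC; apply: lerD => //.
rewrite addnS /zigzag -mulrBl normrM (ger0_norm (_ : 0 <= N%:R^-1)) ?invr_ge0 //.
rewrite ler_pM2r ?invr_gt0 //; move: (x + y)%N => z.
have lt_z := ltn_pmod z N_gt0.
have [le1 le2] : (minn (z.+1 %% N) (N - z.+1 %% N) <=
      minn (z %% N) (N - z %% N) + 1)%N /\
    (minn (z %% N) (N - z %% N) <= minn (z.+1 %% N) (N - z.+1 %% N) + 1)%N.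
  rewrite modnS; case: ifP => [/dvdnP[d dE]|_]; last by lia.
  have -> : (z %% N)%N = N.-1.
    have -> : z = (d.-1 * N + N.-1)%N by case: d dE => // d; lia.
    by rewrite modnMDl modn_small //; lia.
  by lia.
by move: le1 le2; rewrite -!(ler_nat R) !natrD ler_norml => *;
  apply/andP; split; lra.
Qed.

(** Since [N] is odd, [N / 2] is not a point of the grid; moving by the closest
    point [H + 1] reflects the zigzag up to half a step. *)
Lemma zigzag_half N H x : N = (2 * H).+1 ->
  `|zigzag N (x + H.+1) + zigzag N x - 1 / 2| <= 1 / 2 / N%:R.
Proof.
move=> NE; have NR_gt0 : 0 < N%:R :> R by rewrite ltr0n NE.
have N_neq0 := lt0r_neq0 NR_gt0.
have lt_x : (x %% N < N)%N by rewrite ltn_pmod // NE.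
have [le1 le2] : (2 * (minn ((x + H.+1) %% N) (N - (x + H.+1) %% N) +
      minn (x %% N) (N - x %% N)) <= N + 1)%N /\
    (N <= 2 * (minn ((x + H.+1) %% N) (N - (x + H.+1) %% N) +
      minn (x %% N) (N - x %% N)) + 1)%N.
  rewrite -modnDml; move: (x %% N)%N lt_x => r lt_r.
  have [lt_rH|le_rH] := ltnP (r + H.+1) N; first by rewrite modn_small //; lia.
  have -> : (r + H.+1)%N = (r + H.+1 - N + N)%N by lia.
  by rewrite modnDr modn_small; lia.
rewrite /zigzag -mulrDl.
move: le1 le2; rewrite -!(ler_nat R) !natrM !natrD.
set z := (minn _ _)%:R + _ => le1 le2; rewrite ler_norml.
have -> : z / N%:R - 1 / 2 = (z - N%:R / 2) / N%:R by field.
by rewrite -mulNr ler_pM2r ?invr_gt0 // ler_pM2r ?invr_gt0 //;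
  apply/andP; split; lra.
Qed.

Lemma sum_period_shift N F c : (forall x, F (x + N)%N = F x) ->
  \sum_(0 <= j < N) F (j + c)%N = \sum_(0 <= j < N) F j.
Proof.
move=> F_per; elim: c => [|c IH].
  by apply: eq_bigr => j _; rewrite addn0.
rewrite -IH; case: N F_per {IH} => [|N] F_per; first by rewrite !big_geq.
rewrite big_nat_recr // [RHS]big_nat_recl //= add0n addrC; congr (_ + _).
  by rewrite addnS -addSn addnC F_per.
by apply: eq_bigr => j _; rewrite addnS.
Qed.

(** Doubling permutes the residues modulo the odd number [N = 2 H + 1]: the
    first [H + 1] of them run through the even representatives, the last [H]
    through the odd ones. *)
Lemma sum_period_double N H F : N = (2 * H).+1 -> (forall x, F (x + N)%N = F x) ->
  \sum_(0 <= j < N) F (2 * j)%N = \sum_(0 <= j < N) F j.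
Proof.
move=> NE F_per.
have split_parity n : \sum_(0 <= j < (2 * n).+1) F j =
    \sum_(0 <= j < n.+1) F (2 * j)%N + \sum_(0 <= j < n) F (2 * j).+1.
  elim: n => [|n IH]; first by rewrite !big_nat1 big_geq // addr0.
  have -> : (2 * n.+1).+1 = (2 * n).+3 by lia.
  rewrite big_nat_recr // big_nat_recr // IH /=.
  rewrite [in RHS]big_nat_recr // [X in _ = _ + X]big_nat_recr //=.
  have -> : (2 * n.+1)%N = (2 * n).+2 by lia.
  by ring.
rewrite NE split_parity (big_cat_nat (n := H.+1)) //=; last by lia.
congr (_ + _); have -> : (2 * H).+1 = (H + H.+1)%N by lia.
rewrite -{1}[H.+1]add0n big_addn addnK.
apply: eq_bigr => j _; rewrite -(F_per (2 * j).+1); congr F; lia.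
Qed.

Lemma sum_period_dilate N H F m : N = (2 * H).+1 ->
  (forall x, F (x + N)%N = F x) ->
  \sum_(0 <= j < N) F (2 ^ m * j)%N = \sum_(0 <= j < N) F j.
Proof.
move=> NE; elim: m F => [|m IH] F F_per.
  by apply: eq_bigr => j _; rewrite mul1n.
rewrite -(sum_period_double NE F_per) -(IH (fun x => F (2 * x)%N)).
  by apply: eq_bigr => j _; rewrite expnS mulnA.
by move=> x; rewrite mulnDr (mul2n N) -addnn addnA !F_per.
Qed.

Definition zigzag_step N m j : R :=
  zigzag N (2 ^ m * j.+1) - zigzag N (2 ^ m * j).

Definition cross_sum N m k : R :=
  \sum_(0 <= j < N) zigzag_step N m j * zigzag_step N k j.

Lemma zigzag_step_period N m j : zigzag_step N m (j + N) = zigzag_step N m j.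
Proof.
by congr (_ - _); apply: zigzag_mod; rewrite -?addSn mulnDr addnC modnMDl.
Qed.

Lemma zigzag_step_le N m j : (0 < N)%N ->
  `|zigzag_step N m j| <= (2 ^ m)%:R / N%:R.
Proof. by move=> ?; rewrite /zigzag_step mulnS addnC zigzag_lipschitz. Qed.

Lemma sum_norm_le N F (A : R) :
  (forall j, `|F j| <= A) -> `|\sum_(0 <= j < N) F j| <= N%:R * A.
Proof.
move=> F_le; apply: le_trans (ler_norm_sum _ _ _) _.
rewrite mulr_natl -[N in leRHS]subn0 -sumr_const_nat.
by apply: ler_sum => j _; exact: F_le.
Qed.

(** Distinct levels are almost orthogonal on an odd grid. The residue [c] with
    [2 ^ m * c = H + 1] modulo [N] plays the role of the translation by
    [2 ^- (m + 1)]: it changes the sign of the increments of level [m], whereas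
    those of the higher levels have that translation as a period. Both
    statements hold up to an error of the order of the mesh. *)
Lemma cross_sum_period_le N H m k : N = (2 * H).+1 -> (m < k)%N ->
  `|cross_sum N m k| <= (2 ^ (k - m))%:R.
Proof.
move=> NE lt_mk; have N_gt0 : (0 < N)%N by rewrite NE.
have NR_gt0 : 0 < N%:R :> R by rewrite ltr0n.
pose c := (H.+1 ^ m.+1)%N.
have unit2 i : ((2 * H.+1) ^ i = 1 %[mod N])%N.
  have -> : (2 * H.+1)%N = N.+1 by lia.
  by rewrite -modnXm -[N.+1]addn1 modnDl modnXm exp1n.
have dilate i n : n = i %[mod N] -> forall j, (j * n = j * i %[mod N])%N.
  by move=> ni j; rewrite -modnMmr ni modnMmr.
have mc : (2 ^ m * c = H.+1 %[mod N])%N.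
  rewrite /c expnS mulnCA -expnMn.
  by rewrite (dilate 1%N) ?muln1.
have kc : (2 ^ k * c = 2 ^ (k - m).-1 %[mod N])%N.
  have -> : (2 ^ k * c)%N = (2 ^ (k - m).-1 * (2 * H.+1) ^ m.+1)%N.
    have kE : k = ((k - m).-1 + m.+1)%N by lia.
    by rewrite {1}kE expnD expnMn mulnA.
  by rewrite (dilate 1%N) ?muln1.
have stepE i j : zigzag_step N i (j + c) =
    zigzag N (2 ^ i * j.+1 + 2 ^ i * c) - zigzag N (2 ^ i * j + 2 ^ i * c).
  by rewrite /zigzag_step -addSn !mulnDr.
have shift_eq i y : (2 ^ i * c = y %[mod N])%N -> forall j,
    zigzag_step N i (j + c) =
    zigzag N (2 ^ i * j.+1 + y) - zigzag N (2 ^ i * j + y).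
  move=> cy j; rewrite stepE; congr (_ - _); apply: zigzag_mod;
  by rewrite -modnDmr cy modnDmr.
have shift_m j : `|zigzag_step N m (j + c) + zigzag_step N m j| <= 1 / N%:R.
  rewrite (shift_eq _ _ mc) /zigzag_step.
  have := zigzag_half (2 ^ m * j.+1) NE; have := zigzag_half (2 ^ m * j) NE.
  set e := 1 / 2 / _; have -> : 1 / N%:R = e + e :> R.
    by rewrite /e; field; exact: lt0r_neq0.
  by rewrite !ler_norml => /andP[? ?] /andP[? ?]; apply/andP; split; lra.
have shift_k j : `|zigzag_step N k (j + c) - zigzag_step N k j| <=
    (2 ^ (k - m))%:R / N%:R.
  rewrite (shift_eq _ _ kc) /zigzag_step.
  have := zigzag_lipschitz (2 ^ k * j.+1) (2 ^ (k - m).-1) N_gt0.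
  have := zigzag_lipschitz (2 ^ k * j) (2 ^ (k - m).-1) N_gt0.
  have -> : (2 ^ (k - m))%:R / N%:R =
    (2 ^ (k - m).-1)%:R / N%:R + (2 ^ (k - m).-1)%:R / N%:R :> R.
    have {1}-> : (k - m = (k - m).-1.+1)%N by lia.
    by rewrite expnS natrM; ring.
  by rewrite !ler_norml => /andP[? ?] /andP[? ?]; apply/andP; split; lra.
have : cross_sum N m k *+ 2 = \sum_(0 <= j < N)
    ((zigzag_step N m (j + c) + zigzag_step N m j) * zigzag_step N k (j + c) -
     zigzag_step N m j * (zigzag_step N k (j + c) - zigzag_step N k j)).
  rewrite mulr2n -{1}[cross_sum N m k](@sum_period_shift N
    (fun j => zigzag_step N m j * zigzag_step N k j) c); last first.
    by move=> x; rewrite !zigzag_step_period.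
  by rewrite -big_split; apply: eq_bigr => j _ /=; ring.
set A := \sum_(0 <= j < N) _ => twiceE.
have : `|A| <= N%:R * ((2 ^ (k - m))%:R / N%:R *+ 2).
  apply: sum_norm_le => j; rewrite mulr2n.
  have k_ge1 : 1 <= (2 ^ (k - m))%:R :> R by rewrite ler1n expn_gt0.
  apply: le_trans (ler_normB _ _) _; rewrite !normrM; apply: lerD.
    rewrite -[leRHS]mulr1; apply: ler_pM => //.
      apply: le_trans (shift_m j) _.
      by rewrite ler_pM2r ?invr_gt0.
    by apply: le_trans (zigzag_diff_le _ _ _) _; lra.
  rewrite -[leRHS]mul1r; apply: ler_pM => //.
  by apply: le_trans (zigzag_diff_le _ _ _) _; lra.
have -> : N%:R * ((2 ^ (k - m))%:R / N%:R *+ 2) = (2 ^ (k - m))%:R *+ 2 :> R.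
  by field; exact: lt0r_neq0.
by rewrite -twiceE normrMn lerMn2r.
Qed.

Lemma cross_sumC N m k : cross_sum N m k = cross_sum N k m.
Proof. by apply: eq_bigr => j _; rewrite mulrC. Qed.

(** Geometric mean of the almost orthogonality with the trivial bounds, which
    are better when the increments of level [m] or [k] are small. *)
Lemma cross_sum_le N H m k : N = (2 * H).+1 -> (m < k)%N ->
  `|cross_sum N m k| ^+ 4 <= (4 ^ (m + k))%:R / N%:R.
Proof.
move=> NE lt_mk; have N_gt0 : (0 < N)%N by rewrite NE.
have NR_gt0 : 0 < N%:R :> R by rewrite ltr0n.
have N_neq0 := lt0r_neq0 NR_gt0.
have le1 := cross_sum_period_le NE lt_mk.
have le2 : `|cross_sum N m k| <= (2 ^ m)%:R.
  rewrite (_ : (2 ^ m)%:R = N%:R * ((2 ^ m)%:R / N%:R * 1)); last by field.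
  apply: sum_norm_le => j; rewrite normrM ler_pM ?zigzag_step_le //.
  by apply: le_trans (zigzag_diff_le _ _ _) _; lra.
have le3 : `|cross_sum N m k| <= (2 ^ m)%:R * (2 ^ k)%:R / N%:R.
  rewrite (_ : (2 ^ m)%:R * _ / _ =
    N%:R * ((2 ^ m)%:R / N%:R * ((2 ^ k)%:R / N%:R))); last by field.
  by apply: sum_norm_le => j; rewrite normrM ler_pM ?zigzag_step_le.
have -> : (4 ^ (m + k))%:R / N%:R = ((2 ^ m)%:R * (2 ^ m)%:R) *
    ((2 ^ (k - m))%:R * ((2 ^ m)%:R * (2 ^ k)%:R / N%:R)) :> R.
  rewrite !mulrA -!natrM -!expnD (_ : 4 = 2 ^ 2)%N // -expnM.
  by congr ((2 ^ _)%:R / _); lia.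
rewrite -[4%N]/(2 + 2)%N exprD expr2.
have := normr_ge0 (cross_sum N m k); set x := `|_| in le1 le2 le3 * => x_ge0.
by apply: ler_pM; rewrite ?mulr_ge0 //; apply: ler_pM.
Qed.

Definition variogram N a : R :=
  \sum_(0 <= x < N) (zigzag N (x + a) - zigzag N x) ^+ 2.

(** As multiplication by [2 ^ m] permutes the residues, a step of the grid seen
    at level [m] amounts to a translation by [2 ^ m] at level 0. *)
Lemma cross_sum_diag N H m : N = (2 * H).+1 ->
  cross_sum N m m = variogram N (2 ^ m).
Proof.
move=> NE; rewrite /variogram -(sum_period_dilate m NE) => [|x].
  apply: eq_bigr => j _.
  by rewrite -expr2 /zigzag_step mulnS [(2 ^ m + _)%N]addnC.
by rewrite addnAC !zigzagDl.
Qed.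

Lemma variogramDl N a : variogram N (a + N) = variogram N a.
Proof. by apply: eq_bigr => x _; rewrite addnA zigzagDl. Qed.

Lemma variogram0 N : variogram N 0 = 0.
Proof. by rewrite /variogram big1 // => x _; rewrite addn0 subrr expr0n. Qed.

Lemma variogram_mod N a k : variogram N (k * N + a) = variogram N a.
Proof.
elim: k => [//|k IH]; rewrite -IH.
have -> : (k.+1 * N + a = k * N + a + N)%N by rewrite mulSn; lia.
exact: variogramDl.
Qed.

Lemma variogram_opp N a : (a <= N)%N -> variogram N (N - a) = variogram N a.
Proof.
move=> le_aN; rewrite /variogram -[LHS](@sum_period_shift N
  (fun x => (zigzag N (x + (N - a)) - zigzag N x) ^+ 2) a) => [|x].
  apply: eq_bigr => x _; rewrite -addnA subnKC // zigzagDl -sqrrN opprB //.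
by rewrite addnAC !zigzagDl.
Qed.

Lemma variogram_ge0 N a : 0 <= variogram N a.
Proof. by apply: sumr_ge0 => x _; exact: sqr_ge0. Qed.

Lemma variogram_le N a : variogram N a <= N%:R.
Proof.
rewrite -[leRHS]mulr1; apply: le_trans (ler_norm _) _; apply: sum_norm_le => x.
rewrite normrX exprn_ile1 //.
by apply: le_trans (zigzag_diff_le _ _ _) _; lra.
Qed.

Lemma variogram_lipschitz N a c : (0 < N)%N ->
  `|variogram N (a + c) - variogram N a| <= c%:R.
Proof.
move=> N_gt0; have NR_gt0 : 0 < N%:R :> R by rewrite ltr0n.
have N_neq0 := lt0r_neq0 NR_gt0; rewrite -sumrB.
rewrite (_ : c%:R = N%:R * (c%:R / N%:R * 1)); last by field.
apply: sum_norm_le => x; rewrite subr_sqr normrM; apply: ler_pM => //.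
  by rewrite opprB addrA subrK addnA zigzag_lipschitz.
have := zigzag_diff_le N (x + (a + c)) x.
have := zigzag_diff_le N (x + a) x.
by rewrite !ler_norml => /andP[? ?] /andP[? ?]; apply/andP; split; lra.
Qed.

(** The increment over [a] steps equals [a] on the rising side and [- a] on the
    falling side; it runs through [a - 1], [a - 3], ... across the peak and
    through [2 - a], [4 - a], ... across the zero. *)
Lemma variogramE N H a : N = (2 * H).+1 -> (2 * a <= N)%N ->
  variogram N a = a%:R ^+ 2 / N%:R - (4 * a%:R ^+ 3 - a%:R) / (3 * N%:R ^+ 2).
Proof.
move=> NE le_aN; have NR_gt0 : 0 < N%:R :> R by rewrite ltr0n NE.
have N_neq0 := lt0r_neq0 NR_gt0.
case: a le_aN => [|a] le_aN.
  by rewrite variogram0 !expr0n /= !(mulr0, mul0r, subrr).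
pose K := (H - a)%N.
have NK : N = (K + a.+1 + K + a)%N by rewrite NE /K; lia.
have K_gt0 : (0 < K)%N by rewrite /K; lia.
have zigzagE r : (r <= N)%N -> zigzag N r = (minn r (N - r))%:R / N%:R.
  rewrite leq_eqVlt => /orP[/eqP->|lt_rN]; last by rewrite /zigzag modn_small.
  by rewrite -[N in LHS]add0n zigzagDl zigzag0 subnn minn0 mul0r.
have sum_sq (u : R) n : \sum_(0 <= i < n) (u + 2 * i%:R) ^+ 2 =
    n%:R * u ^+ 2 + 2 * u * n%:R * (n%:R - 1) +
    2 / 3 * n%:R * (n%:R - 1) * (2 * n%:R - 1).
  elim: n => [|n IH]; first by rewrite big_geq // !(mul0r, mulr0, addr0).
  by rewrite big_nat_recr //= IH -natr1; field.
have rise j : (j < K)%N -> zigzag N (j + a.+1) - zigzag N j = a.+1%:R / N%:R.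
  move=> lt_jK; rewrite !zigzagE -?mulrBl; [|lia|lia].
  have -> : minn (j + a.+1) (N - (j + a.+1)) = (j + a.+1)%N by lia.
  have -> : minn j (N - j) = j by lia.
  by rewrite natrD addrC addKr.
have peak i : (i < a.+1)%N ->
    zigzag N (K + i + a.+1) - zigzag N (K + i) = - (- a%:R + 2 * i%:R) / N%:R.
  move=> lt_ia; rewrite !zigzagE -?mulrBl; [|lia|lia].
  have -> : minn (K + i + a.+1) (N - (K + i + a.+1)) = (K + a - i)%N by lia.
  have -> : minn (K + i) (N - (K + i)) = (K + i)%N by lia.
  by rewrite natrB ?natrD; [congr (_ / _); ring|lia].
have fall j : (j < K)%N -> zigzag N (K + a.+1 + j + a.+1) -
    zigzag N (K + a.+1 + j) = - a.+1%:R / N%:R.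
  move=> lt_jK; rewrite !zigzagE -?mulrBl; [|lia|lia].
  have -> : minn (K + a.+1 + j + a.+1) (N - (K + a.+1 + j + a.+1)) =
    (K - j.+1)%N by lia.
  have -> : minn (K + a.+1 + j) (N - (K + a.+1 + j)) = (K - j.+1 + a.+1)%N.
    by lia.
  by rewrite natrD opprD addrA subrr sub0r.
have zero i : (i < a)%N -> zigzag N (K + a.+1 + K + i + a.+1) -
    zigzag N (K + a.+1 + K + i) = (1 - a%:R + 2 * i%:R) / N%:R.
  move=> lt_ia.
  have -> : (K + a.+1 + K + i + a.+1 = i.+1 + N)%N by lia.
  rewrite zigzagDl !zigzagE -?mulrBl; [|lia|lia].
  have -> : minn i.+1 (N - i.+1) = i.+1 by lia.
  have -> : minn (K + a.+1 + K + i) (N - (K + a.+1 + K + i)) = (a - i)%N by lia.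
  congr (_ / _); rewrite natrB; last exact: ltnW.
  have -> : i.+1%:R = i%:R + 1 :> R by rewrite natr1.
  by ring.
rewrite /variogram {1}NK (big_cat_nat (n := K)) //=; last by lia.
rewrite [X in _ + X](big_cat_nat (n := (K + a.+1)%N)) //=; [|lia|lia].
rewrite [X in _ + (_ + X)](big_cat_nat (n := (K + a.+1 + K)%N)) //=; [|lia|lia].
have shift u v F : \sum_(u <= i < u + v) F i = \sum_(0 <= i < v) F (u + i)%N.
  rewrite -{1}[u]add0n big_addn addKn.
  by apply: eq_bigr => i _; rewrite addnC.
rewrite (shift K) (shift (K + a.+1)%N) (shift (K + a.+1 + K)%N).
have -> : \sum_(0 <= j < K) (zigzag N (j + a.+1) - zigzag N j) ^+ 2 =
          K%:R * (a.+1%:R / N%:R) ^+ 2.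
  rewrite mulr_natl -[X in _ *+ X]subn0 -sumr_const_nat.
  by apply: eq_big_nat => j /andP[_ /rise->].
have -> : \sum_(0 <= i < K) (zigzag N (K + a.+1 + i + a.+1) -
    zigzag N (K + a.+1 + i)) ^+ 2 = K%:R * (a.+1%:R / N%:R) ^+ 2.
  rewrite mulr_natl -[X in _ *+ X]subn0 -sumr_const_nat.
  by apply: eq_big_nat => j /andP[_ /fall->]; rewrite mulNr sqrrN.
have -> : \sum_(0 <= i < a.+1) (zigzag N (K + i + a.+1) -
    zigzag N (K + i)) ^+ 2 =
    (\sum_(0 <= i < a.+1) (- a%:R + 2 * i%:R) ^+ 2) / N%:R ^+ 2.
  rewrite mulr_suml; apply: eq_big_nat => j /andP[_ /peak->].
  by rewrite mulNr sqrrN expr_div_n.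
have -> : \sum_(0 <= i < a) (zigzag N (K + a.+1 + K + i + a.+1) -
    zigzag N (K + a.+1 + K + i)) ^+ 2 =
    (\sum_(0 <= i < a) (1 - a%:R + 2 * i%:R) ^+ 2) / N%:R ^+ 2.
  rewrite mulr_suml; apply: eq_big_nat => j /andP[_ /zero->].
  by rewrite expr_div_n.
rewrite !sum_sq; have -> : N%:R = 2 * K%:R + 2 * a%:R + 1 :> R.
  by rewrite NK !natrD -natr1; ring.
have : 2 * K%:R + 2 * a%:R + 1 != 0 :> R.
  have : 0 <= K%:R :> R by []; have : 0 <= a%:R :> R by [].
  by move=> ? ?; rewrite gt_eqF //; lra.
have -> : a.+1%:R = a%:R + 1 :> R by rewrite natr1.
by move=> ?; field.
Qed.

End OddGrid.

(** * The mean path on odd grids *)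

Section OddMeanPath.
Variable R : realType.
Implicit Types (m k N M j : nat).
Local Notation q := (root_half R).

Lemma level_takagi_grid m N j : (0 < N)%N -> (j <= N)%N ->
  level (fun _ _ => 1) m (j%:R / N%:R) = q ^+ m * zigzag R N (2 ^ m * j).
Proof.
move=> N_gt0 le_jN; have NR_gt0 : 0 < N%:R :> R by rewrite ltr0n.
have N_neq0 := lt0r_neq0 NR_gt0.
set x := (2 ^ m * j)%N; have lt_r := ltn_pmod x N_gt0.
have f01 : 0 <= ((x %% N)%:R / N%:R : R) <= 1.
  by rewrite divr_ge0 //= ler_pdivrMr // mul1r ler_nat ltnW.
rewrite (level_takagi (d := x %/ N) f01); last first.
  rewrite mulrA -natrX -natrM -/x {1}(divn_eq x N) natrD natrM.
  by field.
congr (_ * _); rewrite /zigzag; case: ifP => [_|/negbT]; last first.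
  rewrite -leqNgt leq_divRL // => le_x.
  have -> : x = (2 ^ m * N)%N.
    by apply/eqP; rewrite eqn_leq le_x leq_mul2l le_jN orbT.
  by rewrite modnMl min0n mul0r.
have : (x %% N <= N - x %% N \/ N - x %% N <= x %% N)%N.
  by apply/orP; exact: leq_total.
case=> le_r; [rewrite (minn_idPl le_r)|rewrite (minn_idPr le_r)].
  have le2 : 2 * (x %% N)%:R <= N%:R :> R by rewrite -natrM ler_nat; lia.
  have : (x %% N)%:R / N%:R <= 1 / 2 :> R by rewrite ler_pdivrMr //; lra.
  by case/andP: f01 => *; case: tentP => *; lra.
have le2 : N%:R <= 2 * (x %% N)%:R :> R by rewrite -natrM ler_nat; lia.
have : 1 / 2 <= (x %% N)%:R / N%:R :> R by rewrite ler_pdivlMr //; lra.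
rewrite natrB 1?ltnW // mulrBl divff //.
by case/andP: f01 => *; case: tentP => *; lra.
Qed.

Lemma energy_takagi_odd N H M : N = (2 * H).+1 -> energy N (@takagi R M) =
  \sum_(0 <= m < M) \sum_(0 <= k < M) q ^+ m * q ^+ k * cross_sum R N m k.
Proof.
move=> NE; have N_gt0 : (0 < N)%N by rewrite NE.
have stepE j : (j < N)%N ->
    @takagi R M (j.+1%:R / N%:R) - @takagi R M (j%:R / N%:R) =
    \sum_(0 <= m < M) q ^+ m * zigzag_step R N m j.
  move=> lt_j; rewrite -sumrB; apply: eq_bigr => m _.
  by rewrite !level_takagi_grid // 1?ltnW // -mulrBr.
rewrite /energy; under eq_big_nat => j /andP[_ lt_j].
  rewrite stepE // expr2 mulr_suml.
  under eq_bigr => m _ do rewrite mulr_sumr.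
  over.
rewrite exchange_big; apply: eq_bigr => m _ /=.
rewrite exchange_big; apply: eq_bigr => k _ /=.
by rewrite mulr_sumr; apply: eq_bigr => j _; ring.
Qed.

(** After weighting, each of the at most [M ^+ 2] terms with distinct levels is
    bounded by [r = N ^ (- 1 / 4)]. *)
Lemma energy_takagi_diag N H M (r : R) : N = (2 * H).+1 ->
  0 <= r -> r ^+ 4 = N%:R^-1 ->
  `|energy N (@takagi R M) - \sum_(0 <= m < M) 2 ^- m * variogram R N (2 ^ m)| <=
  M%:R ^+ 2 * r.
Proof.
move=> NE r_ge0 r4; rewrite (energy_takagi_odd M NE) -sumrB.
have -> : M%:R ^+ 2 * r = M%:R * (M%:R * r) :> R by ring.
apply: le_trans (ler_norm_sum _ _ _) _.
apply: (@le_trans _ _ (\sum_(0 <= m < M) (M%:R * r))); last first.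
  by rewrite sumr_const_nat subn0 [leRHS]mulr_natl.
rewrite big_nat [leRHS]big_nat; apply: ler_sum => m /andP[_ lt_mM].
have q2 : q ^+ m * q ^+ m = 2 ^- m.
  by rewrite -expr2 -exprM mulnC exprM root_half2 div1r exprVn.
have -> : \sum_(0 <= k < M) q ^+ m * q ^+ k * cross_sum R N m k -
    2 ^- m * variogram R N (2 ^ m) = \sum_(0 <= k < M)
    if k == m then 0 else q ^+ m * q ^+ k * cross_sum R N m k.
  rewrite !big_mkord (bigD1 (Ordinal lt_mM)) //= q2 (cross_sum_diag _ _ NE).
  rewrite addrAC subrr add0r [RHS](bigD1 (Ordinal lt_mM)) //= eqxx add0r.
  apply: eq_bigr => k neq_k.
  by rewrite -[m]/(val (Ordinal lt_mM)) (inj_eq val_inj) (negPf neq_k).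
apply: sum_norm_le => k; case: eqP => [_|/eqP neq_km]; first by rewrite normr0.
have q4 i : (q ^+ i) ^+ 4 * (4 ^ i)%:R = 1.
  rewrite natrX (_ : 4 = 2 * 2 :> R); last by ring.
  rewrite exprMn; transitivity ((q ^+ i * q ^+ i * 2 ^+ i) ^+ 2); first by ring.
  by rewrite root_halfX2 expr1n.
have bound : `|cross_sum R N m k| ^+ 4 <= (4 ^ (m + k))%:R / N%:R.
  have [lt_mk|lt_km|/eqP] := ltngtP m k; last by rewrite eq_sym (negPf neq_km).
    exact: cross_sum_le NE lt_mk.
  by rewrite cross_sumC addnC; exact: cross_sum_le NE lt_km.
have : (q ^+ m * q ^+ k * `|cross_sum R N m k|) ^+ 4 <= r ^+ 4.
  rewrite r4 !exprMn; apply: le_trans (ler_wpM2l _ bound) _.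
    by rewrite mulr_ge0 // exprn_ge0 // root_halfX_ge0.
  rewrite expnD natrM mulrA [_ * (_ * _)]mulrACA !q4 mulr1 mul1r.
  exact: lexx.
rewrite ler_pXn2r ?nnegrE ?mulr_ge0 ?root_halfX_ge0 // => le_r.
by rewrite !normrM !(ger0_norm (root_halfX_ge0 _ _)).
Qed.

End OddMeanPath.

(** * Powers of three just above powers of two *)

Section PowersOfThree.
Variable R : archiRealFieldType.
Implicit Types (x y u v w : R) (n l j k B K : nat).

Lemma one_plus_le_expr x n : -1 <= x -> 1 + n%:R * x <= (1 + x) ^+ n.
Proof.
move=> x_ge; elim: n => [|n IH]; first by rewrite mul0r addr0.
rewrite exprS -natr1.
apply: le_trans (ler_wpM2l _ IH); last lra.
have := sqr_ge0 x; have : 0 <= n%:R :> R by []; nra.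
Qed.

(** With [0 < n] these ratios differ from all powers of two, which makes the
    strict inequalities of the Euclidean algorithm below automatic. *)
Definition three_two x : Prop :=
  exists n l, (0 < n)%N /\ x * 2 ^+ l = 3 ^+ n.

Lemma three_two_exp x k : (0 < k)%N -> three_two x -> three_two (x ^+ k).
Proof.
move=> k_gt0 [n [l [n_gt0 xE]]]; exists (n * k)%N, (l * k)%N.
by rewrite muln_gt0 n_gt0 k_gt0 !exprM -exprMn xE.
Qed.

Lemma three_two_half x k : three_two x -> three_two (x / 2 ^+ k).
Proof.
move=> [n [l [n_gt0 xE]]]; exists n, (l + k)%N; split=> //.
rewrite exprD -xE; field.
by rewrite expf_neq0 // pnatr_eq0.
Qed.

Lemma three_two_neq x k : three_two x -> x != 2 ^+ k.
Proof.
move=> [n [l [n_gt0 xE]]]; apply/eqP => x2; move: xE.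
rewrite x2 -exprD -!natrX => /eqP; rewrite eqr_nat => /eqP pow_eq.
have := congr1 odd pow_eq; rewrite !oddX orbT orbF => /eqP kl0.
have : (1 < 3 ^ n)%N by rewrite -[1%N](expn0 3) ltn_exp2l.
by rewrite -pow_eq kl0 ltnn.
Qed.

Lemma last_power_le x : 1 < x -> exists k, x ^+ k <= 2 < x ^+ k.+1.
Proof.
move=> x_gt1.
have ex_k : exists k, 2 < x ^+ k.
  have inv_ge0 : 0 <= (x - 1)^-1 by rewrite invr_ge0 subr_ge0 ltW.
  exists (Num.bound (x - 1)^-1).
  have := one_plus_le_expr (Num.bound (x - 1)^-1) (_ : -1 <= x - 1).
  rewrite subrKC => bernoulli; apply: lt_le_trans (bernoulli _); last lra.
  have := archi_boundP inv_ge0; rewrite -div1r ltr_pdivrMr ?subr_gt0 //; lra.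
case: (ex_minnP ex_k) => [[|k]]; first by rewrite expr0; lra.
move=> lt2 min_k; exists k; rewrite lt2 andbT leNgt; apply/negP => /min_k.
by rewrite ltnn.
Qed.

(** The Euclidean algorithm for [ln 3] and [ln 2], written multiplicatively. If
    [x ^+ k <= 2 < x ^+ k.+1], then [x ^+ k.+1 / 2] and [2 / x ^+ k] have
    product [x], so that the square of one of them is at most [x]; the second
    one is the inverse of an admissible ratio, which is repaired by dividing 2 by
    its largest power not exceeding 2. *)
Lemma three_two_step x : three_two x -> 1 < x <= 2 ->
  exists y, [/\ three_two y, 1 < y & y ^+ 2 <= x].
Proof.
move=> x32 /andP[x_gt1 x_le2].
have x_gt0 : 0 < x by lra.
have [k /andP[le_k lt_k]] := last_power_le x_gt1.
have k_gt0 : (0 < k)%N by case: k {le_k} lt_k => //; rewrite expr1; lra.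
have xk_gt0 : 0 < x ^+ k by rewrite exprn_gt0.
pose u := x ^+ k.+1 / 2; pose v := 2 / x ^+ k.
have uv : u * v = x.
  by rewrite /u /v exprS; field; exact: lt0r_neq0.
have u_gt1 : 1 < u by rewrite /u; lra.
have u32 : three_two u.
  by have := three_two_half 1 (three_two_exp (ltn0Sn k) x32); rewrite expr1.
have [le_ux|lt_xu] := leP (u ^+ 2) x; first by exists u.
have v_gt1 : 1 < v.
  rewrite /v ltr_pdivlMr // mul1r lt_neqAle le_k andbT.
  exact: (three_two_neq 1 (three_two_exp k_gt0 x32)).
have v2_le : v ^+ 2 <= x.
  have uvE : u ^+ 2 * v ^+ 2 = x ^+ 2 by rewrite -exprMn uv.
  have : 0 <= v ^+ 2 by exact: sqr_ge0.
  by move: uvE; move: (u ^+ 2) (v ^+ 2) lt_xu => a c; nra.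
have [j /andP[le_j lt_j]] := last_power_le v_gt1.
have j_gt0 : (0 < j)%N.
  case: j {le_j} lt_j => //; rewrite expr1 /v ltr_pdivlMr //.
  by have : 1 < x ^+ k by [rewrite exprn_egt1 // -lt0n|]; lra.
have vj_gt0 : 0 < v ^+ j by rewrite exprn_gt0 //; lra.
have wE : 2 / v ^+ j = x ^+ (k * j) / 2 ^+ j.-1.
  case: (j) j_gt0 => // i _; rewrite /v expr_div_n exprM /= [2 ^+ _.+1]exprS.
  by field; rewrite !expf_neq0 ?lt0r_neq0.
have w32 : three_two (2 / v ^+ j).
  by rewrite wE; apply/three_two_half/three_two_exp => //; rewrite muln_gt0 k_gt0.
exists (2 / v ^+ j); split=> //.
  rewrite lt_neqAle eq_sym (three_two_neq 0 w32) /=.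
  by rewrite ler_pdivlMr // mul1r.
apply: le_trans v2_le.
have w_ge0 : 0 <= 2 / v ^+ j by rewrite divr_ge0 // ltW.
have v_ge0 : 0 <= v by lra.
rewrite (ler_sqr w_ge0 v_ge0).
by rewrite ler_pdivrMr // mulrC -exprSr ltW.
Qed.

Lemma three_two_small K :
  exists x, [/\ three_two x, 1 < x & x ^+ (2 ^ K) <= 2].
Proof.
elim: K => [|K [x [x32 x_gt1 x_le]]].
  exists (3 / 2); split; [|lra|rewrite expr1; lra].
  by exists 1%N, 1%N; split=> //; field.
have x_le2 : x <= 2.
  apply: le_trans x_le; rewrite -{1}[x]expr1.
  by apply: ler_weXn2l; rewrite ?expn_gt0 // ltW.
have [|y [y32 y_gt1 y_le]] := three_two_step x32; first by rewrite x_gt1.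
exists y; split=> //; rewrite expnS exprM.
by apply: le_trans x_le; apply: lerXn2r; rewrite ?nnegrE ?exprn_ge0; lra.
Qed.

(** If [x ^+ (2 ^ K) <= 2] for [K] large compared with [B] and [j], then the
    power [x ^+ B.+1], whose exponent of 3 exceeds [B], is still within a factor
    [1 + 4 ^- j] of 1, by Bernoulli's inequality. *)
Lemma three_pow_near_two_pow B j : exists n l, [/\ (B < n)%N,
  (2 ^ l <= 3 ^ n)%N & 3 ^+ n <= 2 ^+ l * (1 + 4 ^- j) :> R].
Proof.
have [x [x32 x_gt1 x_le]] := three_two_small (B.+1 + 2 * j).
have [n [l [n_gt0 yE]]] := x32.
have x_ge0 : 0 <= x by lra.
have l2 : 0 < 2 ^+ (l * B.+1) :> R by rewrite exprn_gt0.
have yE' : 3 ^+ (n * B.+1) = 2 ^+ (l * B.+1) * x ^+ B.+1.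
  by rewrite !exprM -exprMn mulrC yE.
exists (n * B.+1)%N, (l * B.+1)%N; split.
- by rewrite leq_pmull.
- by rewrite -(ler_nat R) !natrX yE' ler_peMr ?ltW ?exprn_egt1.
rewrite yE' ler_pM2l //; rewrite leNgt; apply/negP => x_gt.
have four_gt0 : 0 < 4 ^+ j :> R by rewrite exprn_gt0.
have : 2 < x ^+ (2 ^ (B.+1 + 2 * j)).
  apply: lt_le_trans (_ : x ^+ (B.+1 * 4 ^ j) <= _); last first.
    apply: ler_weXn2l; first exact: ltW.
    by rewrite expnD expnM leq_mul2r ltnW ?orbT // ltn_expl.
  rewrite exprM; apply: le_lt_trans (_ : (1 + 4 ^- j) ^+ (4 ^ j) < _).
    apply: le_trans (one_plus_le_expr _ _); last first.
      by have : 0 <= 4 ^- j :> R by [rewrite invr_ge0 ltW|]; lra.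
    by rewrite natrX mulfV ?lt0r_neq0.
  have lhs_ge0 : 0 <= 1 + 4 ^- j :> R by rewrite addr_ge0 // invr_ge0 ltW.
  by rewrite ltr_pXn2r ?expn_gt0 // nnegrE ?exprn_ge0.
by rewrite ltNge x_le.
Qed.

End PowersOfThree.

(** * The mean path on triadic grids close to dyadic ones *)

Section NearDyadic.
Variable R : realType.
Implicit Types (m k n N M l j : nat).
Local Notation q := (root_half R).

Lemma sum_half l M : (l <= M)%N ->
  \sum_(l <= m < M) 2 ^- m = 2 * 2 ^- l - 2 * 2 ^- M :> R.
Proof.
elim: M => [|M IH]; first by rewrite leqn0 => /eqP->; rewrite big_geq // subrr.
rewrite leq_eqVlt => /orP[/eqP->|le_lM]; first by rewrite big_geq // subrr.
have M2 : (2 : R) ^+ M != 0 by rewrite expf_neq0 // pnatr_eq0.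
by rewrite big_nat_recr //= IH // [2 ^+ M.+1]exprS; field; rewrite M2
  expf_neq0 ?pnatr_eq0.
Qed.

(** Levels below [l] see the exact variogram formula. At the levels [l + s] the
    step [2 ^ (l + s)] is close to the multiple [2 ^ s * N'], and the deviation
    [2 ^ s * (N' - 2 ^ l)] is balanced against the trivial bound by a geometric
    mean, which makes the errors summable in [s]. *)
Lemma variogram_series N H N' l M (T e : R) : N = (2 * H).+1 ->
  (2 ^ l <= N')%N -> (N' <= N)%N -> (N <= 3 * N')%N -> (l <= M)%N ->
  0 <= e <= 1 -> N'%:R <= 2 ^+ l * (1 + e ^+ 2) ->
  (forall s : nat, variogram R N (2 ^ s * N') = T) ->
  `|\sum_(0 <= m < M) 2 ^- m * variogram R N (2 ^ m) -
    (2 ^+ l / N%:R - N%:R^-1 - 4 / 9 * ((2 ^+ l / N%:R) ^+ 2 - N%:R^-1 ^+ 2) +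
     l%:R * N%:R^-1 ^+ 2 / 3 + T * (2 * 2 ^- l - 2 * 2 ^- M))| <= 12 * e.
Proof.
move=> NE le_l le_N' le_N le_lM /andP[e_ge0 e_le1] N'_le TE.
have N_gt0 : (0 < N)%N by rewrite NE.
have NR_gt0 : 0 < N%:R :> R by rewrite ltr0n.
have N_neq0 := lt0r_neq0 NR_gt0.
have l2_gt0 : 0 < 2 ^+ l :> R by rewrite exprn_gt0.
rewrite (big_cat_nat (leq0n l) le_lM) /=.
have low i : (i <= l)%N -> \sum_(0 <= m < i) 2 ^- m * variogram R N (2 ^ m) =
    2 ^+ i / N%:R - N%:R^-1 - 4 / 9 * ((2 ^+ i / N%:R) ^+ 2 - N%:R^-1 ^+ 2) +
    i%:R * N%:R^-1 ^+ 2 / 3.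
  elim: i => [|i IH] le_il.
    by rewrite big_geq // expr0 (_ : 0%:R = 0 :> R) //; field.
  have i2 : (2 : R) ^+ i != 0 by rewrite expf_neq0 // pnatr_eq0.
  rewrite big_nat_recr //= IH ?(ltnW le_il) // (variogramE _ NE); last first.
    rewrite -expnS; apply: leq_trans (leq_trans le_l le_N').
    by rewrite leq_exp2l.
  have -> : i.+1%:R = i%:R + 1 :> R by rewrite natr1.
  rewrite natrX [2 ^+ i.+1]exprS; field.
  by rewrite i2 N_neq0.
rewrite low // -sum_half // mulr_sumr.
set A := (X in X + _ - _); have -> (x y : R) : A + x - (A + y) = x - y by ring.
rewrite -sumrB.
have N'E : exists D, N' = (2 ^ l + D)%N by exists (N' - 2 ^ l)%N; rewrite subnKC.
have [D N'D] := N'E.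
have D_le : D%:R <= 2 ^+ l * e ^+ 2.
  by move: N'_le; rewrite N'D natrD natrX; lra.
have T_ge0 : 0 <= T by rewrite -(TE 0%N) variogram_ge0.
have T_le : T <= N%:R by rewrite -(TE 0%N) variogram_le.
have N_le6 : N%:R <= 6 * 2 ^+ l :> R.
  have : N%:R <= 3 * N'%:R :> R by rewrite -natrM ler_nat.
  have : e ^+ 2 <= 1 by rewrite exprn_ile1.
  move: N'_le; nra.
have term s : `|2 ^- (l + s) * variogram R N (2 ^ (l + s)) - T * 2 ^- (l + s)| <=
    3 * e * q ^+ s.
  rewrite [T * _]mulrC -mulrBr normrM ger0_norm ?invr_ge0 ?exprn_ge0 //.
  set x := `|_ - T|.
  have s2_gt0 : 0 < 2 ^+ s :> R by rewrite exprn_gt0.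
  have x1 : x <= 2 ^+ s * (2 ^+ l * e ^+ 2).
    have -> : x = `|variogram R N (2 ^ (l + s) + 2 ^ s * D) -
                    variogram R N (2 ^ (l + s))|.
      by rewrite /x distrC -(TE s) N'D mulnDr -expnD [(s + l)%N]addnC.
    apply: le_trans (variogram_lipschitz _ _ _ N_gt0) _.
    by rewrite natrM natrX ler_pM2l.
  have x2 : x <= 6 * 2 ^+ l.
    rewrite /x ler_norml; have := variogram_ge0 R N (2 ^ (l + s)).
    have := variogram_le R N (2 ^ (l + s)) => *; apply/andP; split; lra.
  have x_ge0 : 0 <= x by exact: normr_ge0.
  have le_sq : (2 ^- (l + s) * x) ^+ 2 <= (3 * e * q ^+ s) ^+ 2.
    apply: (@le_trans _ _ ((2 ^- (l + s)) ^+ 2 *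
        ((2 ^+ s * (2 ^+ l * e ^+ 2)) * (6 * 2 ^+ l)))).
      rewrite exprMn ler_wpM2l ?sqr_ge0 // [x ^+ 2]expr2.
      by apply: ler_pM.
    have -> : (2 ^- (l + s)) ^+ 2 *
        (2 ^+ s * (2 ^+ l * e ^+ 2) * (6 * 2 ^+ l)) = 6 * e ^+ 2 * 2 ^- s.
      by rewrite exprD; field; rewrite !lt0r_neq0.
    have -> : (3 * e * q ^+ s) ^+ 2 = 9 * e ^+ 2 * 2 ^- s.
      rewrite !exprMn -[q ^+ s ^+ 2]exprM mulnC exprM root_half2 div1r exprVn.
      by congr (_ * _ * _); ring.
    rewrite ler_wpM2r ?invr_ge0 ?exprn_ge0 //.
    by have := sqr_ge0 e; lra.
  have lhs_ge0 : 0 <= 2 ^- (l + s) * x by rewrite mulr_ge0 ?invr_ge0 ?exprn_ge0.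
  have rhs_ge0 : 0 <= 3 * e * q ^+ s by rewrite !mulr_ge0 ?root_halfX_ge0.
  by rewrite -(ler_sqr lhs_ge0 rhs_ge0).
apply: le_trans (ler_norm_sum _ _ _) _.
rewrite -{1}[l]add0n big_addn.
apply: (@le_trans _ _ (\sum_(0 <= s < M - l) 3 * e * q ^+ s)).
  by apply: ler_sum => s _; rewrite addnC; exact: term.
rewrite -mulr_sumr sum_root_half // expr0.
have qM := root_halfX_ge0 R (M - l).
have q_lt : q <= 3 / 4.
  by have := root_half2 R; have := root_half_gt0 R; nra.
have : (1 - q ^+ (M - l)) / (1 - q) <= 4 by rewrite ler_pdivrMr; nra.
by nra.
Qed.

(** All error terms are polynomials times a negative power of [2 ^+ n]. A root
    [y] of high order of [1 / 2] leaves enough factors [y ^+ n] to absorb the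
    polynomials and still have a geometric bound. *)
Lemma exists_root_decay : exists y : R, [/\ 0 < y, y < 1 & y ^+ 16 = 1 / 2].
Proof.
have root (x : R) : 0 < x < 1 -> exists y, 0 < y < 1 /\ y ^+ 2 = x.
  move=> /andP[x_gt0 x_lt1]; have s2 := sqr_sqrtr (ltW x_gt0).
  have s_gt0 : 0 < Num.sqrt x by rewrite sqrtr_gt0.
  by exists (Num.sqrt x); split=> //; rewrite s_gt0 /=; nra.
have [|a [a01 aE]] := root (1 / 2); first by apply/andP; split; lra.
have [b [b01 bE]] := root a a01; have [c [c01 cE]] := root b b01.
have [d [/andP[d_gt0 d_lt1] dE]] := root c c01.
exists d; split=> //.
by rewrite (_ : 16 = 2 * 2 * 2 * 2)%N // !exprM dE cE bE aE.
Qed.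

Lemma nat_geometric_le (y : R) n : 0 < y -> y < 1 ->
  n%:R * y ^+ n <= (1 - y)^-1.
Proof.
move=> y_gt0 y_lt1; have y1 : 0 < 1 - y by rewrite subr_gt0.
rewrite -div1r ler_pdivlMr //.
(* The left-hand side is at most [y + ... + y ^ n] times [1 - y]. *)
suff : n%:R * y ^+ n * (1 - y) <= 1 - y ^+ n.
  by have : 0 <= y ^+ n; [rewrite exprn_ge0 // ltW|lra].
elim: n => [|n IH]; first by rewrite !mul0r expr0 subrr.
have yn : 0 <= y ^+ n by rewrite exprn_ge0 // ltW.
have ny : 0 <= n%:R * y ^+ n * (1 - y) by rewrite !mulr_ge0 // ltW.
rewrite exprS -natr1.
have : y * (n%:R * y ^+ n * (1 - y)) <= n%:R * y ^+ n * (1 - y).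
  by rewrite ler_piMl // ltW.
have : y * (y ^+ n * (1 - y)) <= y ^+ n * (1 - y).
  by rewrite ler_piMl ?mulr_ge0 // ltW.
by lra.
Qed.

Lemma cvg_geometric_dist (u : nat -> R) (a C y : R) : 0 < y -> y < 1 ->
  (forall n, `|u n - a| <= C * y ^+ n) -> u @ \oo --> a.
Proof.
move=> y_gt0 y_lt1 u_le; apply/cvgrPdist_le => e e_gt0.
have y_norm : `|y| < 1 by rewrite gtr0_norm.
have /cvgrPdist_le/(_ e e_gt0) := cvg_geometric C y_norm.
apply: filterS => n; rewrite sub0r normrN distrC => le_e.
by apply: le_trans (u_le n) (le_trans (ler_norm _) le_e).
Qed.

(** The error is of the order of [k ^+ 2 * y ^+ (4 k)]: two of the four factors
    [y ^+ k] absorb the polynomial. *)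
Lemma energy_takagi_diag_decay (y : R) k : 0 < y -> y < 1 -> y ^+ 16 = 1 / 2 ->
  `|energy (3 ^ k) (@takagi R (8 * k)) -
    \sum_(0 <= m < 8 * k) 2 ^- m * variogram R (3 ^ k) (2 ^ m)| <=
  64 * (1 - y) ^- 2 * y ^+ k.
Proof.
move=> y_gt0 y_lt1 y16.
have y_ge0 := ltW y_gt0; have y1 : 0 < 1 - y by rewrite subr_gt0.
have NE : (3 ^ k)%N = (2 * (3 ^ k)./2).+1.
  by rewrite -[LHS]odd_double_half oddX orbT -muln2 mulnC.
have N_gt0 : 0 < (3 ^ k)%:R :> R by rewrite ltr0n expn_gt0.
pose r : R := Num.sqrt (Num.sqrt (3 ^ k)%:R^-1).
have r_ge0 : 0 <= r by exact: sqrtr_ge0.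
have r4 : r ^+ 4 = (3 ^ k)%:R^-1.
  by rewrite (_ : 4 = 2 * 2)%N // exprM !sqr_sqrtr ?sqrtr_ge0 ?invr_ge0 // ltW.
apply: le_trans (energy_takagi_diag _ NE r_ge0 r4) _.
have r_le : r <= y ^+ (4 * k).
  rewrite -(@ler_pXn2r _ 4) ?nnegrE ?exprn_ge0 // r4 -exprM mulnAC exprM y16.
  rewrite div1r exprVn lef_pV2 ?posrE ?exprn_gt0 // -natrX ler_nat.
  by case: (k) => // i; rewrite leq_exp2r.
have ky : k%:R * y ^+ k <= (1 - y)^-1 by exact: nat_geometric_le.
have yk_ge0 : 0 <= y ^+ k by rewrite exprn_ge0.
have yk_le1 : y ^+ k <= 1 by rewrite exprn_ile1 // ltW.
apply: le_trans (ler_wpM2l _ r_le) _; first exact: sqr_ge0.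
have -> : (8 * k)%:R ^+ 2 * y ^+ (4 * k) =
    64 * (k%:R * y ^+ k) ^+ 2 * (y ^+ k * y ^+ k).
  by rewrite natrM mulnC exprM; ring.
apply: ler_pM; rewrite ?mulr_ge0 ?sqr_ge0 //; last by rewrite ler_piMl.
rewrite ler_wpM2l // -exprVn; apply: lerXn2r; rewrite ?nnegrE ?mulr_ge0 //.
by rewrite invr_ge0 ltW.
Qed.

End NearDyadic.

Section TriadicLimits.
Variables (R : realType) (y : R).
Hypotheses (y_gt0 : 0 < y) (y_lt1 : y < 1) (y16 : y ^+ 16 = 1 / 2).
Implicit Types (n l j : nat).

Lemma half_pow_le_decay j : 2 ^- j <= y ^+ j.
Proof.
have -> : 2 ^- j = y ^+ (16 * j) :> R by rewrite exprM y16 div1r exprVn.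
by apply: ler_wiXn2l; [exact: ltW|exact: ltW|lia].
Qed.

Lemma decay_trans n j (A C x z w : R) : 0 <= A -> 0 <= C -> (j <= n)%N ->
  `|x - z| <= A * y ^+ n -> `|z - w| <= C * 2 ^- j ->
  `|x - w| <= (A + C) * y ^+ j.
Proof.
move=> A_ge0 C_ge0 le_jn xz zw; rewrite -(subrKA z) mulrDl.
apply: le_trans (ler_normD _ _) _; apply: lerD.
  apply: le_trans xz _; rewrite ler_wpM2l //.
  by apply: ler_wiXn2l => //; exact: ltW.
by apply: le_trans zw _; rewrite ler_wpM2l // half_pow_le_decay.
Qed.

Let C : R := 64 * (1 - y) ^- 2.

Let C_ge0 : 0 <= C.
Proof. by rewrite mulr_ge0 // invr_ge0 sqr_ge0. Qed.

Lemma three_pow_odd n : (3 ^ n)%N = (2 * (3 ^ n)./2).+1.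
Proof. by rewrite -[LHS]odd_double_half oddX orbT -muln2 mulnC. Qed.

Section NearTwoPower.
Variables n l j : nat.
Hypotheses (lt_jn : (j < n)%N) (le_l : (2 ^ l <= 3 ^ n)%N).
Hypothesis le_n : 3 ^+ n <= 2 ^+ l * (1 + 4 ^- j) :> R.

Let e : R := 2 ^- j.

Let e_sq : 4 ^- j = e ^+ 2.
Proof.
rewrite /e exprVn -exprM mulnC exprM; congr (_ ^+ _)^-1.
by rewrite expr2; ring.
Qed.

Let e01 : 0 <= e <= 1.
Proof.
by rewrite invr_ge0 exprn_ge0 //= invf_le1 ?exprn_ege1 ?exprn_gt0 ?ler1n.
Qed.

Let ratio : 2 ^+ l / (3 ^ n)%:R <= 1 :> R /\
  1 <= 2 ^+ l / (3 ^ n)%:R * (1 + e ^+ 2) :> R.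
Proof.
have N_gt0 : 0 < (3 ^ n)%:R :> R by rewrite ltr0n expn_gt0.
split; first by rewrite ler_pdivrMr // mul1r -natrX ler_nat.
by rewrite mulrAC ler_pdivlMr // mul1r natrX -e_sq.
Qed.

Let inv_le (k : nat) : (n <= k)%N -> (3 ^ k)%:R^-1 <= e.
Proof.
move=> le_nk; rewrite lef_pV2 ?posrE ?ltr0n ?expn_gt0 ?exprn_gt0 //.
rewrite -natrX ler_nat; apply: (@leq_trans (2 ^ k)).
  by rewrite leq_exp2l // (leq_trans _ le_nk) // ltnW.
by case: (k) => // i; rewrite leq_exp2r.
Qed.

Let l_le N : (2 ^ l <= N)%N -> (0 < N)%N ->
  0 <= l%:R * N%:R^-1 ^+ 2 / 3 :> R /\ l%:R * N%:R^-1 ^+ 2 / 3 <= N%:R^-1 :> R.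
Proof.
move=> le_lN N_gt0; have NR_gt0 : 0 < N%:R :> R by rewrite ltr0n.
have N_neq0 := lt0r_neq0 NR_gt0.
split; first by rewrite divr_ge0 // mulr_ge0 // sqr_ge0.
have -> : l%:R * N%:R^-1 ^+ 2 / 3 = (l%:R / N%:R / 3) * N%:R^-1 :> R by field.
rewrite -[leRHS]mul1r ler_wpM2r ?invr_ge0 // -mulrA -invfM.
rewrite ler_pdivrMr ?mulr_gt0 // mul1r -natrM ler_nat.
by apply: leq_trans (ltnW (ltn_expl l (ltnSn 1))) _; lia.
Qed.

(** Here [N = N' = 3 ^ n], so that the steps [2 ^ s * N'] are periods and
    contribute nothing; with [2 ^+ l / N] close to 1, the levels below [l]
    give [1 - 4 / 9]. *)
Lemma energy_takagi_near_two_pow :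
  `|energy (3 ^ n) (@takagi R (8 * n)) - 5 / 9| <= (C + 20) * y ^+ j.
Proof.
apply: decay_trans C_ge0 _ (ltnW lt_jn)
  (energy_takagi_diag_decay n y_gt0 y_lt1 y16) _ => //.
have N_gt0 : (0 < 3 ^ n)%N by rewrite expn_gt0.
have N_le : (3 ^ n)%:R <= 2 ^+ l * (1 + e ^+ 2) by rewrite natrX -e_sq.
have le_lM : (l <= 8 * n)%N.
  rewrite -(leq_exp2l (m := 2)) //; apply: leq_trans le_l _.
  rewrite expnM; case: (n) => // i; rewrite leq_exp2r //.
have T0 s : variogram R (3 ^ n) (2 ^ s * 3 ^ n) = 0.
  by rewrite -[(2 ^ s * _)%N]addn0 variogram_mod variogram0.
have le_N3 : (3 ^ n <= 3 * 3 ^ n)%N by rewrite leq_pmull.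
have := variogram_series (three_pow_odd n) le_l (leqnn _) le_N3 le_lM e01 N_le T0.
rewrite mul0r addr0 -/e.
have := l_le le_l N_gt0; have [] := ratio; have := inv_le (leqnn n).
have : 0 <= (3 ^ n)%:R^-1 :> R by rewrite invr_ge0.
case/andP: e01; move: (l%:R * _ / 3) (\sum_(_ <= m < _) _) => a S.
move: ((3 ^ n)%:R^-1) (2 ^+ l / _) => s r e_ge0 e_le1 s_ge0 s_le r_le r_ge.
move=> [a_ge0 a_le] S_le.
have r_ge' : 1 - e <= r by nra.
have r2_le : r ^+ 2 <= 1 by nra.
have r2_ge : 1 - 2 * e <= r ^+ 2 by nra.
have s2_ge : 0 <= s ^+ 2 by exact: sqr_ge0.
have s2_le : s ^+ 2 <= e by nra.
by move: S_le; rewrite !ler_norml => /andP[? ?]; apply/andP; split; lra.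
Qed.

(** Here [N = 3 N'] with [N' = 3 ^ n], so that the steps [2 ^ s * N'] are one or
    two thirds of a period, where the variogram is about [5 N / 81]. With [2 ^+
    l / N] close to [1 / 3], the levels below [l] give [1 / 3 - 4 / 81] and the
    other ones [10 / 27]. *)
Lemma energy_takagi_near_three_two_pow :
  `|energy (3 ^ n.+1) (@takagi R (8 * n.+1)) - 53 / 81| <= (C + 40) * y ^+ j.
Proof.
apply: decay_trans C_ge0 _ (leqW (ltnW lt_jn))
  (energy_takagi_diag_decay n.+1 y_gt0 y_lt1 y16) _ => //.
have N_gt0 : (0 < 3 ^ n.+1)%N by rewrite expn_gt0.
have NR_gt0 : 0 < (3 ^ n)%:R :> R by rewrite ltr0n expn_gt0.
have NE : (3 ^ n.+1)%N = (3 * 3 ^ n)%N by rewrite expnS.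
have N_le : (3 ^ n)%:R <= 2 ^+ l * (1 + e ^+ 2) by rewrite natrX -e_sq.
have le_lM : (l <= 8 * n.+1)%N.
  rewrite -(leq_exp2l (m := 2)) //; apply: leq_trans le_l _.
  by rewrite expnM; apply: leq_trans (_ : 3 ^ n.+1 <= _)%N;
    rewrite ?leq_exp2l ?leq_exp2r.
pose T := variogram R (3 ^ n.+1) (3 ^ n).
have TE s : variogram R (3 ^ n.+1) (2 ^ s * 3 ^ n) = T.
  have T2 : variogram R (3 ^ n.+1) (2 * 3 ^ n) = T.
    by rewrite -[RHS]variogram_opp ?leq_exp2l // NE; congr variogram; lia.
  have : ((2 ^ s %% 3 == 1) || (2 ^ s %% 3 == 2))%N.
    elim: s => // i; rewrite expnS -modnMmr.
    by case/orP => /eqP->.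
  rewrite [X in (X * _)%N](divn_eq _ 3) mulnDl -mulnA -NE variogram_mod.
  by case/orP => /eqP->; rewrite ?mul1n.
have T_val : T = 5 / 27 * (3 ^ n)%:R + (3 ^ n)%:R^-1 / 27.
  rewrite /T (variogramE R (three_pow_odd n.+1)); last by rewrite NE leq_mul2r orbT.
  by rewrite NE natrM; field; exact: lt0r_neq0.
have le_N : (3 ^ n <= 3 ^ n.+1)%N by rewrite leq_exp2l.
have le_N3 : (3 ^ n.+1 <= 3 * 3 ^ n)%N by rewrite NE.
have := variogram_series (three_pow_odd n.+1) le_l le_N le_N3 le_lM e01 N_le TE.
have [] := l_le (leq_trans le_l le_N) N_gt0.
rewrite -/e; set S := \sum_(_ <= m < _) _ => a_ge0 a_le.
have [] := ratio; have := inv_le (leqnn n); have := inv_le (leqnSn n).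
have l2_gt0 : 0 < 2 ^+ l :> R by rewrite exprn_gt0.
pose r : R := 2 ^+ l / (3 ^ n)%:R.
have -> : 2 ^+ l / (3 ^ n.+1)%:R = r / 3 :> R.
  by rewrite /r NE natrM; field; exact: lt0r_neq0.
have TS : T * (2 * 2 ^- l - 2 * 2 ^- (8 * n.+1)) =
    10 / 27 * r^-1 + 2 / 27 * (3 ^ n)%:R^-1 * 2 ^- l - 2 * T * 2 ^- (8 * n.+1).
  by rewrite T_val /r; field; rewrite !lt0r_neq0 ?exprn_gt0.
have T_ge0 : 0 <= T by exact: variogram_ge0.
have tail_le : T * 2 ^- (8 * n.+1) <= e.
  rewrite ler_pdivrMr ?exprn_gt0 //.
  apply: le_trans (variogram_le R (3 ^ n.+1) (3 ^ n)) _.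
  rewrite mulrC ler_pdivlMr ?exprn_gt0 // -natrX -natrX -natrM ler_nat.
  apply: (@leq_trans ((2 ^ 2) ^ n.+1 * 2 ^ n)).
    by apply: leq_mul; [rewrite leq_exp2r|rewrite leq_exp2l // ltnW].
  by rewrite -expnM -expnD leq_pexp2l //; clear; lia.
have tail_ge0 : 0 <= T * 2 ^- (8 * n.+1).
  by rewrite mulr_ge0 // invr_ge0 exprn_ge0.
have l2V : 0 <= (2 ^- l : R) <= 1.
  by rewrite invr_ge0 exprn_ge0 //= invf_le1 ?exprn_ege1 ?ler1n.
rewrite TS -/r.
have r_gt0 : 0 < r by rewrite divr_gt0.
have : 0 <= (3 ^ n)%:R^-1 :> R by rewrite invr_ge0.
have : 0 <= (3 ^ n.+1)%:R^-1 :> R by rewrite invr_ge0.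
move: tail_le tail_ge0 l2V a_ge0 a_le; rewrite -[2 * T * _]mulrA.
move: (T * 2 ^- (8 * n.+1)) (l%:R * _ / 3) (2 ^- l) => b a p.
move: ((3 ^ n.+1)%:R^-1) ((3 ^ n)%:R^-1) => s u.
move=> b_le b_ge0 /andP[p_ge0 p_le1] a_ge0 a_le s_ge0 u_ge0.
move=> s_le u_le r_le r_ge S_le; case/andP: (e01) => e_ge0 e_le1.
have rV_ge : 1 <= r^-1 by rewrite invf_ge1.
have rV_le : r^-1 <= 1 + e.
  by rewrite -div1r ler_pdivrMr //; nra.
have r_ge' : 1 - e <= r by nra.
have r2_le : r ^+ 2 <= 1 by nra.
have r2_ge : 1 - 2 * e <= r ^+ 2 by nra.
have s2_ge : 0 <= s ^+ 2 by exact: sqr_ge0.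
have s2_le : s ^+ 2 <= e by nra.
have up_ge : 0 <= u * p by exact: mulr_ge0.
have up_le : u * p <= e by nra.
move: S_le; rewrite expr_div_n -[2 / 27 * u * p]mulrA.
by rewrite !ler_norml => /andP[? ?]; apply/andP; split; lra.
Qed.

End NearTwoPower.
End TriadicLimits.

(** * Almost sure convergence *)

Section AlmostSure.
Context (d : measure_display) (Omega : measurableType d) (R : realType)
  (P : probability Omega R).

(** Probabilities dominated by a geometric series are summable, so that the
    Borel-Cantelli lemma applies. *)
Lemma ae_eventually_geometric (A : nat -> set Omega) (K y : R) :
  0 < y -> y < 1 -> 0 <= K -> (forall n, measurable (A n)) ->
  (forall n, (P (A n) <= (K * y ^+ n)%:E)%E) ->
  {ae P, forall w, exists n0, forall n, (n0 <= n)%N -> ~ A n w}.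
Proof.
move=> y_gt0 y_lt1 K_ge0 A_meas A_le.
have y1 : 0 < 1 - y by rewrite subr_gt0.
have sum_le n : (\sum_(0 <= i < n) P (A i) <=
    (K * ((1 - y ^+ n) / (1 - y)))%:E)%E.
  elim: n => [|n IH].
    by rewrite big_geq // expr0 subrr mul0r mulr0.
  rewrite big_nat_recr //=; apply: le_trans (leeD IH (A_le n)) _.
  rewrite -EFinD lee_fin exprS le_eqVlt; apply/orP; left; apply/eqP; field.
  exact: lt0r_neq0.
have A_sum : (\sum_(0 <= n <oo) P (A n) < +oo)%E.
  apply: (@le_lt_trans _ _ (K / (1 - y))%:E); last exact: ltry.
  apply: lime_le; first by apply: is_cvg_nneseries => n _ _; exact: measure_ge0.
  apply: nearW => n; apply: le_trans (sum_le n) _.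
  rewrite lee_fin ler_wpM2l // ler_pdivrMr // mulVf ?lt0r_neq0 //.
  by rewrite gerBl exprn_ge0 // ltW.
have limsup0 := lim_sup_set_cvg0 A_meas A_sum.
exists (lim_sup_set A); split=> //.
  apply: bigcap_measurable => // n _.
  by apply: bigcup_measurable => k _; exact: A_meas.
move=> w /= not_ev n _; apply: contrapT => not_in; apply: not_ev.
exists n => k le_nk Ak; apply: not_in; exists k => //.
Qed.

Variables (nu : R) (theta : forall m : nat, 'I_(2 ^ m) -> {RV P >-> R}).
Hypothesis nu01 : 0 < nu < 1.
Hypothesis theta_indep : mutually_independent
  (fun i : {m : nat & 'I_(2 ^ m)} => theta (tagged i)).
Hypothesis theta_pos : forall (m : nat) (k : 'I_(2 ^ m)),
  P [set w | theta k w = 1] = nu%:E.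
Hypothesis theta_neg : forall (m : nat) (k : 'I_(2 ^ m)),
  P [set w | theta k w = -1] = (1 - nu)%:E.

Lemma measurable_theta m (k : 'I_(2 ^ m)) (x : R) :
  measurable [set w | theta k w = x].
Proof.
have -> : [set w | theta k w = x] = theta k @^-1` [set x] by [].
exact: measurable_funPTI.
Qed.

Lemma ae_theta_sign :
  {ae P, forall w, forall m (k : 'I_(2 ^ m)), theta k w = 1 \/ theta k w = -1}.
Proof.
have one m (k : 'I_(2 ^ m)) :
    {ae P, forall w, theta k w = 1 \/ theta k w = -1}.
  exists (~` ([set w | theta k w = 1] `|` [set w | theta k w = -1])); split.
  - by apply: measurableC; apply: measurableU; exact: measurable_theta.
  - rewrite probability_setC; last by apply: measurableU; exact: measurable_theta.
    rewrite measureU; [|exact: measurable_theta|exact: measurable_theta|].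
      transitivity (1 - (nu%:E + (1 - nu)%:E))%E.
        by congr (_ - (_ + _))%E; [exact: theta_pos|exact: theta_neg].
      by rewrite -EFinD subrKC subrr.
    by rewrite -subset0 => w [/= -> e]; exfalso; lra.
  - by move=> w /=.
have : {ae P, forall w, forall m i (lt_i : (i < 2 ^ m)%N),
    theta (Ordinal lt_i) w = 1 \/ theta (Ordinal lt_i) w = -1}; last first.
  by apply: filterS => w tw m [i lt_i]; exact: tw.
apply: ae_foralln => m; apply: ae_foralln => i.
have [lt_i|le_i] : (i < 2 ^ m \/ 2 ^ m <= i)%N by case: ltnP; [left|right].
  apply: filterS (one m (Ordinal lt_i)) => w tw lt'_i.
  by rewrite (bool_irrelevance lt'_i lt_i).
by apply: aeW => w lt_i; move: le_i; rewrite leqNgt lt_i.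
Qed.

Section Atoms.
Variable M : nat.
Local Notation node := {m : 'I_M & 'I_(2 ^ m)}.
Implicit Types (s : {ffun node -> bool}) (a : node).

Definition atom s : set Omega :=
  [set w | forall a, theta (tagged a) w = spin R (s a)].

Definition node_index a : {m : nat & 'I_(2 ^ m)} :=
  existT (fun m => 'I_(2 ^ m)) (tag a) (tagged a).

Lemma node_index_inj : injective node_index.
Proof.
move=> [[m lt_m] k] [[n lt_n] l] /= e.
have mn : m = n := congr1 tag e.
move: lt_n l e; rewrite -{n}mn => lt_n l.
move=> /eqP; rewrite /node_index -tag_eqE /= /tag_eq /= eqxx tagged_asE /=.
by move=> /eqP->; rewrite (bool_irrelevance lt_m lt_n).
Qed.

Lemma atomE s : atom s = \bigcap_(i in [set` [fset node_index a | a : node]%fset])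
  (theta (tagged i) @^-1` [set signs R s (tagged i)]).
Proof.
apply/seteqP; split=> w /= sw.
  move=> i /= /imfsetP[a _ ->] /=.
  by rewrite (signsE R s a); exact: sw.
move=> a; rewrite -(signsE R s a).
by apply: (sw (node_index a)); rewrite /= in_imfset.
Qed.

Lemma measurable_atom s : measurable (atom s).
Proof.
rewrite atomE; apply: fin_bigcap_measurable; first exact: finite_fset.
by move=> i _; exact: measurable_funPTI.
Qed.

Lemma probability_atom s : P (atom s) = (cube_weight nu s)%:E.
Proof.
rewrite atomE theta_indep => [|i _]; last exact: measurable_set1.
rewrite big_imfset /=; last by move=> a c _ _; exact: node_index_inj.
rewrite -prodEFin big_enum /=; apply: eq_bigr => a _.
rewrite (signsE R s a) /bernoulli_weight /spin.
by case: (s a); [exact: theta_pos|exact: theta_neg].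
Qed.

Lemma probability_atoms (B : pred {ffun node -> bool}) :
  (P (\big[setU/set0]_(s | B s) atom s) <= (\sum_(s | B s) cube_weight nu s)%:E)%E.
Proof.
rewrite -sumEFin.
suff: measurable (\big[setU/set0]_(s | B s) atom s) /\
  (P (\big[setU/set0]_(s | B s) atom s) <= \sum_(s | B s) (cube_weight nu s)%:E)%E.
  by case.
elim/big_rec2: _ => [|s x A _ [mA le_A]]; first by rewrite measure0.
have ms := measurable_atom s; split; first exact: measurableU.
apply: le_trans (measureU2 _ ms mA) _; apply: leeD le_A.
by rewrite -[leRHS]probability_atom; exact: lexx.
Qed.

End Atoms.

Local Notation q := (root_half R).

Let b : R := 2 * nu - 1.

Let Y (w : Omega) : R -> R := faber_schauder_series (fun m k => theta k w).

(* Used with [v = 4 ^- n], where [2 ^- (8 n) = v ^+ 4] and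
   [q ^+ (8 n) = v ^+ 2]. *)
Let absorb (a v e : R) : 0 <= a -> 0 <= v -> v <= 1 -> a * v <= 3 -> v <= e ->
  a * (16 * (2 * (v * v))) <= 96 * e /\ a * (4 * (v * v * (v * v))) <= 12 * e.
Proof.
move=> a_ge0 v_ge0 v_le1 av v_le.
have vv : v * v <= 1 by nra.
have avv : a * v * v <= 3 * v by nra.
have avv_ge0 : 0 <= a * v * v by rewrite !mulr_ge0.
have avvvv : a * v * v * (v * v) <= a * v * v by nra.
by split; lra.
Qed.

Let split_error (x0 x1 x2 E S : R) :
  x2 = b ^+ 2 * E + (1 - b ^+ 2) * S ->
  x0 - (b ^+ 2 * E + (1 - b ^+ 2)) =
  (x0 - x1) + (x1 - x2) + (1 - b ^+ 2) * (S - 1).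
Proof. by move=> ->; ring. Qed.

Let decay_exponents n : (n * 3 + 9 * n + 2 * n * 2 = 16 * n)%N.
Proof. by lia. Qed.

Let absorb_inv (x r e : R) : 0 <= r -> r <= e ->
  `|x - (1 - r)| <= 12 * e -> `|x - 1| <= 13 * e.
Proof.
by rewrite !ler_norml => ? ? /andP[? ?]; apply/andP; split; lra.
Qed.

(** The exceptional event at step [n] is a deviation of the truncated energy by
    more than [y ^+ (2 n)]. Its probability is at most of the order of [n ^ 3 /
    N / y ^+ (4 n)], hence of [n ^ 3 y ^+ (12 n)], which is summable. The
    constant 110 adds up 96 for the truncation at level [8 n], 1 for the
    fluctuation and 13 for the remainder in Parseval's identity. *)
Lemma ae_energy_dist (N : nat -> nat) (y : R) :
  0 < y -> y < 1 -> y ^+ 16 = 1 / 2 ->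
  (forall n, (2 ^ n <= N n)%N) -> (forall n, (N n <= 3 * 4 ^ n)%N) ->
  {ae P, forall w, exists n0, forall n, (n0 <= n)%N ->
    `|energy (N n) (Y w) -
      (b ^+ 2 * energy (N n) (@takagi R (8 * n)) + (1 - b ^+ 2))| <=
    110 * y ^+ n}.
Proof.
move=> y_gt0 y_lt1 y16 N_ge N_le; have y_ge0 := ltW y_gt0.
have y1 : 0 < 1 - y by rewrite subr_gt0.
have [nu_gt0 nu_lt1] := andP nu01.
have nu01' : 0 <= nu <= 1 by rewrite !ltW.
have N_gt0 n : (0 < N n)%N by apply: leq_trans (N_ge n); rewrite expn_gt0.
have half_y n : 2 ^- n = y ^+ (16 * n) by rewrite exprM y16 div1r exprVn.
have quarter_y n : 4 ^- n = y ^+ (32 * n).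
  have -> : (32 * n = 16 * n * 2)%N by lia.
  rewrite exprM -half_y exprVn -exprM mulnC exprM; congr (_ ^+ _)^-1.
  by rewrite expr2; ring.
have y_le n k : (n <= k)%N -> y ^+ k <= y ^+ n.
  by move=> le_nk; apply: ler_wiXn2l => //; exact: ltW.
pose Q n (s : {ffun {m : 'I_(8 * n) & 'I_(2 ^ m)} -> bool}) : R :=
  energy (N n) (partial (signs R s) (8 * n)).
pose far n (s : {ffun {m : 'I_(8 * n) & 'I_(2 ^ m)} -> bool}) : bool :=
  y ^+ (2 * n) < `|Q n s - cube_mean nu (Q n)|.
pose A n := \big[setU/set0]_(s | far n s) atom s.
have A_meas n : measurable (A n).
  by apply: bigsetU_measurable => s _; exact: measurable_atom.
pose c := (1 - y)^-1.
have c_ge0 : 0 <= c by rewrite invr_ge0 ltW.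
pose K : R := 16 * 8 ^+ 3.
have K_ge0 : 0 <= K by rewrite mulr_ge0 // exprn_ge0.
have A_le n : (P (A n) <= (K * c ^+ 3 * y ^+ n)%:E)%E.
  apply: le_trans (probability_atoms (far n)) _; rewrite lee_fin.
  apply: le_trans (energy_concentration (8 * n) nu01' (N_gt0 n)
    (exprn_gt0 (2 * n) y_gt0)) _.
  have NV_le : (N n)%:R^-1 <= y ^+ (16 * n).
    rewrite -half_y lef_pV2 ?posrE ?exprn_gt0 ?ltr0n ?N_gt0 //.
    by rewrite -natrX ler_nat.
  have ny : n%:R * y ^+ n <= c by exact: nat_geometric_le.
  have yn := exprn_ge0 n y_ge0.
  apply: (@le_trans _ _
    (16 * (8 * n)%:R ^+ 3 * y ^+ (16 * n) / (y ^+ (2 * n)) ^+ 2)).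
    by rewrite ler_wpM2r ?invr_ge0 ?sqr_ge0 // ler_wpM2l.
  have -> : 16 * (8 * n)%:R ^+ 3 * y ^+ (16 * n) / (y ^+ (2 * n)) ^+ 2 =
      K * (n%:R * y ^+ n) ^+ 3 * y ^+ (9 * n).
    have -> : y ^+ (16 * n) = (y ^+ n) ^+ 3 * y ^+ (9 * n) * (y ^+ (2 * n)) ^+ 2.
      by rewrite -!exprM -!exprD decay_exponents.
    by rewrite natrM /K; field; exact: lt0r_neq0 (exprn_gt0 _ y_gt0).
  have ny_ge0 : 0 <= n%:R * y ^+ n by rewrite mulr_ge0.
  apply: ler_pM.
  - by rewrite mulr_ge0 // exprn_ge0.
  - exact: exprn_ge0.
  - by rewrite ler_wpM2l //; exact: lerXn2r.
  - by apply: y_le; exact: leq_pmull.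
have ev := ae_eventually_geometric y_gt0 y_lt1
  (mulr_ge0 K_ge0 (exprn_ge0 3 c_ge0)) A_meas A_le.
apply: filterS2 ae_theta_sign ev => w w_sign [n0 w_ev]; exists n0 => n le_n.
have := w_ev n le_n; rewrite /A => not_bad.
have theta_le m (k : 'I_(2 ^ m)) : `|theta k w| <= 1.
  by case: (w_sign m k) => ->; rewrite ?normrN normr1.
pose s : {ffun {m : 'I_(8 * n) & 'I_(2 ^ m)} -> bool} :=
  [ffun a => theta (tagged a) w == 1].
have w_s : atom s w.
  move=> a /=; rewrite ffunE /spin; case: eqP => [//|neq1].
  by case: (w_sign _ (tagged a)).
have partialE t : partial (fun m k => theta k w) (8 * n) t =
    partial (signs R s) (8 * n) t.
  by rewrite partial_nodes partial_signsE; apply: eq_bigr => a _; rewrite w_s.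
have trunc : `|energy (N n) (Y w) - Q n s| <=
    (N n)%:R * (16 * (2 * q ^+ (8 * n))).
  have -> : Q n s = energy (N n) (partial (fun m k => theta k w) (8 * n)).
    by apply: eq_bigr => j _; rewrite !partialE.
  apply: energy_dist => [|j|t|t].
  - by rewrite mulr_ge0 // root_halfX_ge0.
  - exact: series_tail.
  - exact: series_le.
  - exact: partial_le.
have fluct : `|Q n s - cube_mean nu (Q n)| <= y ^+ (2 * n).
  rewrite leNgt; apply/negP => far_s; apply: not_bad.
  by rewrite (bigD1 s) //=; left.
have meanE := mean_energy (8 * n) nu (N n).
have pars := sum_schauder_increments R (8 * n) (N_gt0 n).
set S := \sum_(0 <= j < N n) _ in pars; rewrite -/b in meanE.
have N_leR : (N n)%:R <= 3 * 4 ^+ n :> R.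
  by rewrite -natrX -natrM ler_nat.
have b2_le1 : b ^+ 2 <= 1 by rewrite /b; nra.
have b2_ge0 : 0 <= b ^+ 2 by exact: sqr_ge0.
pose v : R := 4 ^- n.
have v_gt0 : 0 < v by rewrite invr_gt0 exprn_gt0.
have v_le1 : v <= 1.
  by rewrite /v invf_le1 ?exprn_gt0 // exprn_ege1 // ler1n.
have v_le : v <= y ^+ n by rewrite /v quarter_y; apply: y_le; exact: leq_pmull.
have Nv : (N n)%:R * v <= 3.
  by rewrite ler_pdivrMr ?exprn_gt0.
have q8 : q ^+ (8 * n) = v * v.
  rewrite /v -invfM -exprMn (_ : 8 * n = 2 * (4 * n))%N; last by rewrite mulnA.
  rewrite exprM root_half2 div1r exprVn exprM; congr (_ ^+ _)^-1.
  by rewrite !exprS expr0; ring.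
have two8 : 2 ^- (8 * n) = v * v * (v * v).
  rewrite /v -!invfM -!exprMn exprM; congr (_ ^+ _)^-1.
  by rewrite !exprS expr0; ring.
have NV_le : (N n)%:R^-1 <= y ^+ n.
  apply: le_trans (y_le n (16 * n)%N (leq_pmull _ _)) => //.
  rewrite -half_y lef_pV2 ?posrE ?exprn_gt0 ?ltr0n ?N_gt0 //.
  by rewrite -natrX ler_nat.
have NR_ge0 : 0 <= (N n)%:R^-1 :> R by rewrite invr_ge0.
have yn_le : y ^+ (2 * n) <= y ^+ n by apply: y_le; exact: leq_pmull.
have absorbed := absorb (ler0n R (N n)) (ltW v_gt0) v_le1 Nv v_le.
have trunc' : `|energy (N n) (Y w) - Q n s| <= 96 * y ^+ n.
  by apply: le_trans trunc _; rewrite q8; exact: absorbed.1.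
have pars' : `|S - (1 - (N n)%:R^-1)| <= 12 * y ^+ n.
  by apply: le_trans pars _; rewrite two8; exact: absorbed.2.
have S1 : `|(1 - b ^+ 2) * (S - 1)| <= 13 * y ^+ n.
  rewrite normrM ger0_norm; last by rewrite subr_ge0.
  rewrite -[leRHS]mul1r; apply: ler_pM => //.
  - by rewrite subr_ge0.
  - by rewrite gerBl.
  exact: absorb_inv NR_ge0 NV_le pars'.
rewrite (split_error (energy (N n) (Y w)) (Q n s) meanE).
apply: le_trans (ler_normD _ _) _; rewrite (_ : 110 = 97 + 13 :> R); last by ring.
rewrite [leRHS]mulrDl; apply: lerD S1.
apply: le_trans (ler_normD _ _) _; rewrite (_ : 97 = 96 + 1 :> R); last by ring.
by rewrite [leRHS]mulrDl mul1r; apply: lerD trunc' (le_trans fluct yn_le).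
Qed.

End AlmostSure.

(** * Limits along the three families of grids *)

Section Limits.
Variable R : realType.
Implicit Types (n j : nat).
Local Notation q := (root_half R).

Lemma root_half_inv : (1 - q)^-1 = 2 + 2 * q.
Proof.
have q_lt := root_half_lt1 R; apply: (mulfI (x := 1 - q)).
  by rewrite gt_eqF // subr_gt0.
by rewrite mulfV ?gt_eqF ?subr_gt0 //; have := root_half2 R; lra.
Qed.

Lemma sqrt2E : Num.sqrt 2 = 2 * q.
Proof.
by rewrite /root_half -{2}(sqr_sqrtr (ler0n R 2)) expr2 mulfK.
Qed.

Lemma cvg_takagi_thirds :
  energy (3 * 2 ^ n) (@takagi R (8 * n)) @[n --> \oo] -->
  (15 + 8 * Num.sqrt 2) / 9.
Proof.
have half_lt1 : 1 / 2 < 1 :> R by lra.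
have half_gt0 : 0 < 1 / 2 :> R by lra.
apply: (cvg_geometric_dist (C := 10) half_gt0 half_lt1) => n.
rewrite energy_takagi_thirds ?leq_pmull // sqrt2E root_half_inv.
pose x := q ^+ (8 * n - n).
have x_ge0 : 0 <= x by exact: root_halfX_ge0.
have x_le : x <= 2 ^- n.
  have -> : 2 ^- n = q ^+ (2 * n) by rewrite exprM root_half2 div1r exprVn.
  apply: ler_wiXn2l; [exact/ltW/root_half_gt0|exact/ltW/root_half_lt1|lia].
have x_le1 : x <= 1.
  by rewrite exprn_ile1 ?ltW ?root_half_gt0 ?root_half_lt1.
have -> : (1 / 2) ^+ n = 2 ^- n :> R by rewrite div1r exprVn.
rewrite -/x; have q2 := root_half2 R; have q_gt0 := root_half_gt0 R.
have q_lt := root_half_lt1 R.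
move: (2 ^- n : R) x_le => v x_le.
have -> : (1 - v) / 3 + 2 / 9 * ((1 - x) * (2 + 2 * q)) ^+ 2 -
  (15 + 8 * (2 * q)) / 9 = - v / 3 - (12 + 16 * q) / 9 * (x * (2 - x)).
  rewrite exprMn (_ : (2 + 2 * q) ^+ 2 = 6 + 8 * q); first by field.
  have -> : (2 + 2 * q) ^+ 2 = 4 + 8 * q + 4 * q ^+ 2 by ring.
  by rewrite q2; field.
have xx : 0 <= x * (2 - x) <= 2 * v by apply/andP; split; nra.
have qq : 0 <= (12 + 16 * q) / 9 <= 28 / 9 by apply/andP; split; lra.
case/andP: xx => ? ?; case/andP: qq => ? ?.
by rewrite ler_norml; apply/andP; split; nra.
Qed.

(** Transfer of a limit from the deterministic centring to the random sums,
    along a subsequence that grows at least like the identity. *)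
Lemma cvg_subseq_dist (u v : nat -> R) (K y a : R) (n_ : nat -> nat) n0 :
  0 < y -> y < 1 -> 0 <= K -> (forall j, (j <= n_ j)%N) ->
  (forall n, (n0 <= n)%N -> `|u n - v n| <= K * y ^+ n) ->
  v (n_ j) @[j --> \oo] --> a -> u (n_ j) @[j --> \oo] --> a.
Proof.
move=> y_gt0 y_lt1 K_ge0 n_ge uv v_cvg; apply/cvgrPdist_le => e e_gt0.
have y_norm : `|y| < 1 by rewrite gtr0_norm.
have e2 : 0 < e / 2 by rewrite divr_gt0.
have /cvgrPdist_le/(_ _ e2) near_v := v_cvg.
have /cvgrPdist_le/(_ _ e2) near_y := cvg_geometric K y_norm.
have near_n : \forall j \near \oo, (n0 <= j)%N by exists n0.
apply: filterS3 near_v near_y near_n => j vj yj le_j.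
rewrite sub0r normrN in yj.
have := uv (n_ j) (leq_trans le_j (n_ge j)); rewrite distrC => uvj.
rewrite -(subrKA (v (n_ j))) [e]splitr; apply: le_trans (ler_normD _ _) _.
apply: lerD => //; apply: le_trans uvj _; apply: le_trans yj.
apply: le_trans (ler_norm _); rewrite /= ler_wpM2l //.
by apply: ler_wiXn2l => //; exact: ltW.
Qed.

Lemma homo_ltn_ge (n_ : nat -> nat) : {homo n_ : i j / (i < j)%N} ->
  forall j, (j <= n_ j)%N.
Proof.
move=> n_homo; elim=> // j IH.
by apply: leq_ltn_trans IH _; exact: n_homo.
Qed.

Lemma exists_near_two_pow_subseq : exists n_ l_ : nat -> nat,
  [/\ {homo n_ : i j / (i < j)%N}, (forall j, (j < n_ j)%N),
      forall j, (2 ^ l_ j <= 3 ^ n_ j)%N &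
      forall j, 3 ^+ n_ j <= 2 ^+ l_ j * (1 + 4 ^- j) :> R].
Proof.
have pick B j : {nl : nat * nat | [/\ (B < nl.1)%N,
    (2 ^ nl.2 <= 3 ^ nl.1)%N & 3 ^+ nl.1 <= 2 ^+ nl.2 * (1 + 4 ^- j) :> R]}.
  apply: cid; have [n [l [? ? ?]]] := three_pow_near_two_pow R B j.
  by exists (n, l).
pose nl := fix nl j : nat * nat :=
  if j is i.+1 then sval (pick (nl i).1 i.+1) else sval (pick 0%N 0%N).
have nlE j : exists B, [/\ (B < (nl j).1)%N, (2 ^ (nl j).2 <= 3 ^ (nl j).1)%N &
    3 ^+ (nl j).1 <= 2 ^+ (nl j).2 * (1 + 4 ^- j) :> R].
  case: j => [|j] /=; first by exists 0%N; exact: svalP (pick 0%N 0%N).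
  by exists (nl j).1; exact: svalP (pick _ _).
have nl_incr j : ((nl j).1 < (nl j.+1).1)%N by case: (svalP (pick (nl j).1 j.+1)).
exists (fun j => (nl j).1), (fun j => (nl j).2); split.
- by apply: homo_ltn => [? ? ?|//]; exact: ltn_trans.
- elim=> [|j IH]; first by case: (svalP (pick 0%N 0%N)).
  exact: leq_ltn_trans IH (nl_incr j).
- by move=> j; case: (nlE j) => B [].
- by move=> j; case: (nlE j) => B [].
Qed.

End Limits.

Theorem theorem2p6 (R : realType) (d : measure_display)
    (Omega : measurableType d) (P : probability Omega R)
    (nu : R) (nu01 : 0 < nu < 1) (nu_neq_half : nu != 1 / 2)
    (theta : forall m : nat, 'I_(2 ^ m) -> {RV P >-> R})
    (theta_indep : mutually_independent
       (fun i : {m : nat & 'I_(2 ^ m)} => theta (tag i) (tagged i)))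
    (theta_pos : forall (m : nat) (k : 'I_(2 ^ m)),
       P [set w | theta m k w = 1] = nu%:E)
    (theta_neg : forall (m : nat) (k : 'I_(2 ^ m)),
       P [set w | theta m k w = -1] = (1 - nu)%:E) :
  let Y (w : Omega) : R -> R :=
    faber_schauder_series (fun m k => theta m k w) in
  let b : R := 2 * nu - 1 in
  [/\ {ae P, forall w,
        quadratic_sum (Y w) (thirds_grid R n) @[n --> \oo]
          --> 1 + (6 + 8 * Num.sqrt 2) / 9 * b ^+ 2},
      1 < 1 + (6 + 8 * Num.sqrt 2) / 9 * b ^+ 2,
      {ae P, forall w,
        ~ cvg (quadratic_sum (Y w) (triadic_grid R n) @[n --> \oo])},
      (exists n_ m_ : nat -> nat,
        [/\ {homo n_ : i j / (i < j)%N},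
            {homo m_ : i j / (i < j)%N} &
            {ae P, forall w,
              (quadratic_sum (Y w) (triadic_grid R (n_ j)) @[j --> \oo]
                 --> 1 - 4 / 9 * b ^+ 2) /\
              (quadratic_sum (Y w) (triadic_grid R (m_ j)) @[j --> \oo]
                 --> 1 - 28 / 81 * b ^+ 2)}]) /\
      ((1 - 28 / 81 * b ^+ 2) - (1 - 4 / 9 * b ^+ 2) = 8 * b ^+ 2 / 81 /\
       0 < 8 * b ^+ 2 / 81) &
      forall s : (forall m : nat, 'I_(2 ^ m) -> R),
        (forall (m : nat) (k : 'I_(2 ^ m)), s m k = 1 \/ s m k = -1) ->
        (forall n : nat,
           quadratic_sum (faber_schauder_series s) (dyadic_grid R n)
             = 1 - 2 ^- n) /\
        (quadratic_sum (faber_schauder_series s) (dyadic_grid R n)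
           @[n --> \oo] --> (1 : R))].
Proof.
move=> Y b.
have b2_gt0 : 0 < b ^+ 2.
  by rewrite exprn_even_gt0 //= /b; apply: contra nu_neq_half => /eqP ?;
    apply/eqP; lra.
have [y [y_gt0 y_lt1 y16]] := exists_root_decay R.
have gridE (x : R -> R) N : quadratic_sum x (uniform_grid R N) = energy N x.
  exact: quadratic_sum_uniform.
have ae_dist := ae_energy_dist nu01 theta_indep theta_pos theta_neg
  y_gt0 y_lt1 y16; rewrite -/b in ae_dist.
have pow3_ge n : (2 ^ n <= 3 ^ n)%N by case: n => // n; rewrite leq_exp2r.
have pow3_le n : (3 ^ n <= 3 * 4 ^ n)%N.
  apply: (@leq_trans (4 ^ n)); last by rewrite leq_pmull.
  by case: n => [|n] //; rewrite leq_exp2r.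
have dist3 := ae_dist (fun n => 3 ^ n)%N pow3_ge pow3_le.
have random_cvg (N k_ : nat -> nat) (a : R) w n0 :
    {homo k_ : i j / (i < j)%N} ->
    (forall n, (n0 <= n)%N -> `|energy (N n) (Y w) -
      (b ^+ 2 * energy (N n) (@takagi R (8 * n)) + (1 - b ^+ 2))| <=
      110 * y ^+ n) ->
    energy (N (k_ j)) (@takagi R (8 * k_ j)) @[j --> \oo] --> a ->
    quadratic_sum (Y w) (uniform_grid R (N (k_ j))) @[j --> \oo] -->
    b ^+ 2 * a + (1 - b ^+ 2).
  move=> k_homo w_dist E_cvg.
  apply: (cvg_subseq_dist (n0 := n0)
    (u := fun n => quadratic_sum (Y w) (uniform_grid R (N n)))
    (v := fun n => b ^+ 2 * energy (N n) (@takagi R (8 * n)) + (1 - b ^+ 2))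
    y_gt0 y_lt1 (ler0n R 110) (homo_ltn_ge k_homo)) => [n le_n0|].
    by rewrite gridE; exact: (w_dist _ le_n0).
  by apply: cvgD; [exact: cvgMl_tmp|exact: cvg_cst].
have [n_ [l_ [n_homo n_gt le_l le_n]]] := exists_near_two_pow_subseq R.
pose m_ j := (n_ j).+1.
have m_homo : {homo m_ : i j / (i < j)%N} by move=> i j /n_homo.
have ae_sub : {ae P, forall w,
    (quadratic_sum (Y w) (triadic_grid R (n_ j)) @[j --> \oo]
       --> 1 - 4 / 9 * b ^+ 2) /\
    (quadratic_sum (Y w) (triadic_grid R (m_ j)) @[j --> \oo]
       --> 1 - 28 / 81 * b ^+ 2)}.
  apply: filterS dist3 => w [n0 w_dist].
  split.
    rewrite (_ : 1 - _ = b ^+ 2 * (5 / 9) + (1 - b ^+ 2)); last by field.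
    apply: (random_cvg _ _ _ _ _ n_homo w_dist).
    apply: (cvg_geometric_dist (C := 64 * (1 - y) ^- 2 + 20) y_gt0 y_lt1) => j.
    exact (energy_takagi_near_two_pow y_gt0 y_lt1 y16
      (n_gt j) (le_l j) (le_n j)).
  rewrite (_ : 1 - _ = b ^+ 2 * (53 / 81) + (1 - b ^+ 2)); last by field.
  apply: (random_cvg _ _ _ _ _ m_homo w_dist).
  apply: (cvg_geometric_dist (C := 64 * (1 - y) ^- 2 + 40) y_gt0 y_lt1) => j.
  exact (energy_takagi_near_three_two_pow y_gt0 y_lt1 y16
    (n_gt j) (le_l j) (le_n j)).
have infty_cvg (k_ : nat -> nat) : {homo k_ : i j / (i < j)%N} ->
    k_ @ \oo --> \oo.
  move=> /homo_ltn_ge k_ge A [B _ BA]; exists B => // j /= le_Bj.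
  by apply: BA => /=; exact: leq_trans (k_ge j).
split.
- have thirds_ge n : (2 ^ n <= 3 * 2 ^ n)%N by rewrite leq_pmull.
  have thirds_le n : (3 * 2 ^ n <= 3 * 4 ^ n)%N.
    by rewrite leq_mul2l /=; case: n => // n; rewrite leq_exp2r.
  apply: filterS (ae_dist _ thirds_ge thirds_le) => w [n0 w_dist].
  have -> : 1 + (6 + 8 * Num.sqrt 2) / 9 * b ^+ 2 =
      b ^+ 2 * ((15 + 8 * Num.sqrt 2) / 9) + (1 - b ^+ 2) by field.
  apply: (random_cvg _ (fun n => n) _ _ _ _ w_dist) => //.
  exact: cvg_takagi_thirds.
- by rewrite ltrDl mulr_gt0 // divr_gt0 // addr_gt0 // mulr_gt0 // sqrtr_gt0.
- apply: filterS ae_sub => w [cvg_n cvg_m] /cvg_ex[a cvg_a].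
  have same_lim (k_ : nat -> nat) (c : R) : {homo k_ : i j / (i < j)%N} ->
      quadratic_sum (Y w) (triadic_grid R (k_ j)) @[j --> \oo] --> c -> a = c.
    move=> k_homo /(cvg_lim (@Rhausdorff R)) <-; apply/esym/cvg_lim => //.
    exact: (cvg_comp _ _ (infty_cvg _ k_homo) cvg_a).
  have eq_n := same_lim _ _ n_homo cvg_n; have eq_m := same_lim _ _ m_homo cvg_m.
  by move: b2_gt0 eq_n eq_m; move: (b ^+ 2) => c; lra.
- split; first by exists n_, m_.
  by split; [field|lra].
move=> s s_sign.
have dyadicE n : quadratic_sum (faber_schauder_series s) (dyadic_grid R n) =
    1 - 2 ^- n by rewrite gridE; exact: energy_dyadic.
split=> //.
have half_lt1 : 1 / 2 < 1 :> R by lra.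
have half_gt0 : 0 < 1 / 2 :> R by lra.
apply: (cvg_geometric_dist (C := 1) half_gt0 half_lt1) => n.
by rewrite dyadicE div1r exprVn mul1r addrAC subrr sub0r normrN ger0_norm.
Qed.
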